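(* Let $\mathcal{M}=(S,\mathit{Act},\mathbf{P},s_I)$ be an MDP (not necessarily with a single end component), $\mathcal{Q}=(\psi_1,\dots,\psi_\ell)$ a query with $\psi_j=\mathbb{E}_{\sim_j}(\mathbf{R}_j\lozenge G_j)$, and $\vec p\in\mathbb{R}^\ell$. Assume that for every $j$, state $s$ and pure stationary strategy $\sigma$, $\mathbb{E}^{\sigma}_{\mathcal{M}_s}(\mathbf{R}_j\lozenge G_j)<\infty$. Let the bounds $U^j_s$ and $X^{\mathcal{E}}_s$ be as in the context. Then the constraint system $\mathcal{C}_1\cup\mathcal{C}_3$ described in the context has a solution if and only if $\vec p\in\mathrm{Ach}_{PS}(\mathcal{M},\mathcal{Q})$.
   Context: MDP: $\mathcal{M}=(S,\mathit{Act},\mathbf{P},s_I)$, $S,\mathit{Act}$ finite, $\mathbf{P}\colon S\times\mathit{Act}\times S\to[0,1]$ with $\sum_{s'}\mathbf{P}(s,\alpha,s')\in\{0,1\}$; $\mathit{Act}(s)=\{\alpha\mid\exists s'.\mathbf{P}(s,\alpha,s')>0\}\neq\emptyset$; $\mathcal{M}_s$ is $\mathcal{M}$ with initial state $s$; $\mathrm{succ}(s,\alpha)=\{s'\mid\mathbf{P}(s,\alpha,s')>0\}$, $\mathrm{pre}(s)=\{(s',\alpha')\mid\mathbf{P}(s',\alpha',s)>0\}$. Strategies (general: histories to distributions over enabled actions; pure stationary: $\sigma\colon S\to\mathit{Act}$, $\sigma(s)\in\mathit{Act}(s)$), expectation $\mathbb{E}^\sigma$. For $\mathbf{R}\colon S\times\mathit{Act}\times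 S\to\mathbb{R}_{\ge0}$, $G\subseteq S$, $(\mathbf{R}\lozenge G)(\pi)=\sum_{i=1}^{n}\mathbf{R}(s_{i-1},\alpha_i,s_i)$, $n$ least with $s_n\in G$ ($\infty$ if none). $\vec p$ achieved by $\sigma$ iff $\mathbb{E}^\sigma_{\mathcal{M}}(\mathbf{R}_j\lozenge G_j)\sim_jp_j$ for all $j$; $\mathrm{Ach}_{PS}(\mathcal{M},\mathcal{Q})$ = points achieved by some pure stationary strategy. $\mathcal{E}\subseteq S\times\mathit{Act}$ is closed if $(s,\alpha)\in\mathcal{E}$ implies $\alpha\in\mathit{Act}(s)$ and $\mathrm{succ}(s,\alpha)\subseteq S_{\mathcal{E}}:=\{s\mid\exists\alpha.(s,\alpha)\in\mathcal{E}\}$; an end component (EC) of a closed $\mathcal{F}$ is a nonempty closed $\mathcal{E}\subseteq\mathcal{F}$ whose states are mutually reachable using only transitions of $\mathcal{E}$; maximal ECs are those not strictly contained in another. $S_0^j=\{s\mid\mathbb{E}^\sigma_{\mathcal{M}_s}(\mathbf{R}_j\lozenge G_j)=0\ \forall\sigma\}$; $S^j_?$ = states $\notin S^j_0$ reachable from $s_I$ without visiting $S^j_0$; $\mathcal{E}^j_?$ = largest closed subset of $S^j_?\times\mathit{Act}$; $\mathrm{MEC}^j$ = set of maximal ECs contained in $\mathcal{E}^j_?$. $U^j_s\in\mathbb{Q}$ ($s\in S^j_?$) with $U^j_s\ge\mathbb{E}^\sigma_{\mathcal{M}_s}(\mathbf{R}_j\lozenge G_j)$ for all strategies $\sigma$.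 For $\mathcal{E}\in\mathrm{MEC}^j$ let $\mathcal{M}^{\mathcal{E}}$ be the MDP with states $S_{\mathcal{E}}\uplus\{s^{\mathcal{E}}_I,s^{\mathcal{E}}_\bot\}$, actions $\mathit{Act}\uplus\{\alpha_I,\bot\}$, initial state $s^{\mathcal{E}}_I$, and transitions: $\mathbf{P}(s,\alpha,s')$ for $(s,\alpha)\in\mathcal{E}$; probability $1/|S_{\mathcal{E}}|$ from $s_I^{\mathcal{E}}$ via $\alpha_I$ to each $s\in S_{\mathcal{E}}$; probability 1 from each $s\in S_{\mathcal{E}}$ to $s_\bot^{\mathcal{E}}$ via $\bot$ and via every $\alpha\in\mathit{Act}(s)$ with $(s,\alpha)\notin\mathcal{E}$; $s^{\mathcal{E}}_\bot$ loops via $\bot$. $X^{\mathcal{E}}_s\in\mathbb{Q}$ ($s\in S_{\mathcal{E}}$) is at least the expected number of visits to $s$ before reaching $s^{\mathcal{E}}_\bot$ in $\mathcal{M}^{\mathcal{E}}$ under any pure stationary strategy of $\mathcal{M}^{\mathcal{E}}$ that reaches $s^{\mathcal{E}}_\bot$ with probability 1. Put $\epsilon_j=1,\mu_j=0$ if $\sim_j$ is $\ge$ and $\epsilon_j=-1,\mu_j=1$ if $\le$. System $\mathcal{C}_1$: variables $a_{s,\alpha}$, $x^j_s$ ($s\in S^j_0\cup S^j_?$), $x^j_{s,\alpha}$ ($s\in S^j_?$); constraints: $a_{s,\alpha}\in\{0,1\}$, $\sum_{\alpha\in\mathit{Act}(s)}a_{s,\alpha}=1$ ($s\in S$); $x^j_s=0$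 ($s\in S^j_0$); for $s\in S^j_?$: $0\le\epsilon_jx^j_s\le U^j_s$ and for $\alpha\in\mathit{Act}(s)$: $0\le\epsilon_jx^j_{s,\alpha}\le U^j_s$, $x^j_{s,\alpha}\le\sum_{s'}\mathbf{P}(s,\alpha,s')(x^j_{s'}+\epsilon_j\mathbf{R}_j(s,\alpha,s'))$, $x^j_{s,\alpha}\le U^j_s(a_{s,\alpha}-\mu_j)$, and $x^j_s\le\sum_{\alpha}x^j_{s,\alpha}+\mu_j(|\mathit{Act}(s)|-1)U^j_s$; and $\epsilon_jx^j_{s_I}\sim_jp_j$. System $\mathcal{C}_3$: for each $j$ and $\mathcal{E}\in\mathrm{MEC}^j$: for $s\in S_{\mathcal{E}}$: $e^j_s\in\{0,1\}$, $\epsilon_jx^j_s\le U^j_s(1-e^j_s)$; for $(s,\alpha)\in\mathcal{E}$: $e^j_{s,\alpha}\in\{0,1\}$, $e^j_{s,\alpha}\le a_{s,\alpha}$, and $e^j_{s,\alpha}\le e^j_{s'}$ for all $s'\in\mathrm{succ}(s,\alpha)$; for $s\in S_{\mathcal{E}}$: $e^j_s=\sum_{\alpha:(s,\alpha)\in\mathcal{E}}e^j_{s,\alpha}$; for $s\in S_{\mathcal{E}}$, $\alpha\in\mathit{Act}(s)$: $0\le z^j_{s,\alpha}\le X^{\mathcal{E}}_sa_{s,\alpha}$; $0\le z^j_{s,\bot}\le X^{\mathcal{E}}_se^j_s$; $z^j_{s,\bot}+\sum_{\alpha\in\mathit{Act}(s)}z^j_{s,\alpha}=\frac{1}{|S_{\mathcal{E}}|}+\sum_{(s',\alpha')\in\mathrm{pre}(s)\cap\mathcal{E}}\mathbf{P}(s',\alpha',s)z^j_{s',\alpha'}$;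 and $1=\sum_{s\in S_{\mathcal{E}}}\big(z^j_{s,\bot}+\sum_{\alpha\in\mathit{Act}(s),(s,\alpha)\notin\mathcal{E}}z^j_{s,\alpha}\big)$. *)

(* Defs.v *)
From HB Require Import structures.
From mathcomp Require Import all_boot all_order all_algebra.
From mathcomp Require Import all_classical all_reals all_analysis.

Set Implicit Arguments.
Unset Strict Implicit.
Unset Printing Implicit Defensive.
Import Order.TTheory GRing.Theory Num.Theory.
Local Open Scope classical_set_scope.
Local Open Scope ring_scope.

Record mdp (R : realType) (S Act : finType) := MDP {
  trans : S -> Act -> S -> R;
  init : S;
  trans_bounds : forall s a s', 0 <= trans s a s' <= 1;
  trans_sum : forall s a,
    \sum_s' trans s a s' = 0 \/ \sum_s' trans s a s' = 1;
  trans_live : forall s, exists a s', 0 < trans s a s'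
}.

Definition enabled (R : realType) (S Act : finType) (M : mdp R S Act) (s : S)
    : {set Act} :=
  [set a | [exists s', 0 < trans M s a s']].

Definition succs (R : realType) (S Act : finType) (M : mdp R S Act)
    (s : S) (a : Act) : {set S} :=
  [set s' | 0 < trans M s a s'].

Definition pres (R : realType) (S Act : finType) (M : mdp R S Act) (s : S)
    : {set S * Act} :=
  [set sa | 0 < trans M sa.1 sa.2 s].

(* The history s_0 a_1 s_1 ... a_n s_n is encoded as the initial state s_0
   together with the sequence (a_1, s_1), ..., (a_n, s_n). *)
Definition hist_last (S Act : finType) (s : S) (h : seq (Act * S)) : S :=
  last s (map snd h).

(* A strategy is total on all such sequences, including those that are not
   paths of M; these have probability 0. *)
Record strategy (R : realType) (S Act : finType) (M : mdp R S Act) := Strategy {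
  choose_act :> S -> seq (Act * S) -> Act -> R;
  choose_act_ge0 : forall s h a, 0 <= choose_act s h a;
  choose_act_sum : forall s h, \sum_a choose_act s h a = 1;
  choose_act_enabled : forall s h a,
    0 < choose_act s h a -> a \in enabled M (hist_last s h)
}.

Record ps_strategy (R : realType) (S Act : finType) (M : mdp R S Act) :=
  PSStrategy {
  ps_act :> S -> Act;
  ps_act_enabled : forall s, ps_act s \in enabled M s
}.

Definition ps_choose (R : realType) (S Act : finType) (M : mdp R S Act)
    (sigma : ps_strategy M) (s : S) (h : seq (Act * S)) (a : Act) : R :=
  (a == sigma (hist_last s h))%:R.

Lemma ps_choose_ge0 (R : realType) (S Act : finType) (M : mdp R S Act)
    (sigma : ps_strategy M) s h a : 0 <= ps_choose sigma s h a.
Proof. exact: ler0n. Qed.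

Lemma ps_choose_sum (R : realType) (S Act : finType) (M : mdp R S Act)
    (sigma : ps_strategy M) s h : \sum_a ps_choose sigma s h a = 1.
Proof.
rewrite (bigD1 (sigma (hist_last s h)))//= /ps_choose eqxx.
by rewrite big1 ?addr0// => a /negPf ->.
Qed.

Lemma ps_choose_enabled (R : realType) (S Act : finType) (M : mdp R S Act)
    (sigma : ps_strategy M) s h a :
  0 < ps_choose sigma s h a -> a \in enabled M (hist_last s h).
Proof.
rewrite /ps_choose; case: eqP => [-> _|_]; last by rewrite ltxx.
exact: ps_act_enabled.
Qed.

Definition strategy_of_ps (R : realType) (S Act : finType) (M : mdp R S Act)
    (sigma : ps_strategy M) : strategy M :=
  Strategy (ps_choose_ge0 sigma) (ps_choose_sum sigma)
    (@ps_choose_enabled R S Act M sigma).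
Coercion strategy_of_ps : ps_strategy >-> strategy.

(* The path s_0 a_1 s_1 a_2 ... is encoded as s_0 and i |-> (a_{i+1}, s_{i+1}).
   All sequences are allowed; the probability measures below give weight 0 to
   transitions of probability 0. *)
Definition ipath (R : realType) (S Act : finType) (M : mdp R S Act) : Type :=
  (S * (nat -> Act * S))%type.

Lemma ipath_inhabited (R : realType) (S Act : finType) (M : mdp R S Act) :
  exists p : ipath M, True.
Proof. by have [a _] := trans_live M (init M); exists (init M, fun=> (a, init M)). Qed.

HB.instance Definition _ (R : realType) (S Act : finType) (M : mdp R S Act) :=
  gen_eqMixin (ipath M).
HB.instance Definition _ (R : realType) (S Act : finType) (M : mdp R S Act) :=
  gen_choiceMixin (ipath M).
HB.instance Definition _ (R : realType) (S Act : finType) (M : mdp R S Act) :=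
  isPointed.Build (ipath M) (projT1 (cid (ipath_inhabited M))).

Definition pstate (R : realType) (S Act : finType) (M : mdp R S Act)
    (p : ipath M) (i : nat) : S :=
  if i is k.+1 then (p.2 k).2 else p.1.

(* paction p i is a_{i+1}, the action taken from pstate p i. *)
Definition paction (R : realType) (S Act : finType) (M : mdp R S Act)
    (p : ipath M) (i : nat) : Act :=
  (p.2 i).1.

Definition cyl (R : realType) (S Act : finType) (M : mdp R S Act)
    (s : S) (h : seq (Act * S)) : set (ipath M) :=
  [set p | p.1 = s /\ mkseq p.2 (size h) = h].

Definition cylinders (R : realType) (S Act : finType) (M : mdp R S Act)
    : set (set (ipath M)) :=
  [set C | exists s h, C = @cyl R S Act M s h].

Definition path_space (R : realType) (S Act : finType) (M : mdp R S Act) :=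
  g_sigma_algebraType (@cylinders R S Act M).

(* cont_prob sigma s g h : probability that the history (s, g) is extended
   by h. *)
Fixpoint cont_prob (R : realType) (S Act : finType) (M : mdp R S Act)
    (sigma : strategy M) (s : S) (g h : seq (Act * S)) : R :=
  if h is (a, s') :: h' then
    sigma s g a * trans M (hist_last s g) a s' *
      cont_prob sigma s (rcons g (a, s')) h'
  else 1.

(* Inverse transform sampling of a letter of r with weights k from v; the
   second component is the rescaled remainder. *)
Fixpoint sample (R : realType) (T : Type) (t0 : T) (k : T -> R) (r : seq T)
    (v : R) : T * R :=
  if r is t :: r' then
    if v < k t then (t, v / k t) else sample t0 k r' (v - k t)
  else (t0, 0).

Fixpoint sample_word (R : realType) (T : finType) (t0 : T)
    (k : seq T -> T -> R) (g : seq T) (v : R) (n : nat) : T :=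
  let tv := sample t0 (k g) (enum T) v in
  if n is n'.+1 then sample_word t0 k (rcons g tv.1) tv.2 n' else tv.1.

Fixpoint word_weight (R : realType) (T : Type) (k : seq T -> T -> R)
    (g h : seq T) : R :=
  if h is t :: h' then k g t * word_weight k (rcons g t) h' else 1.

Lemma sample_range (R : realType) (T : eqType) (t0 : T) (k : T -> R) r v :
  (forall t, 0 <= k t) -> 0 <= v -> 0 <= (sample t0 k r v).2 < 1.
Proof.
move=> k0; elim: r v => [|t r IH] v v0 /=; first by rewrite lexx ltr01.
case: ltP => [vk|kv] /=; last by apply: IH; rewrite subr_ge0.
have kt : 0 < k t by exact: le_lt_trans vk.
by rewrite divr_ge0//= ltr_pdivrMr// mul1r.
Qed.

Lemma sample_itv (R : realType) (T : eqType) (t0 : T) (k : T -> R) r t l m :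
  (forall t, 0 <= k t) -> t \in r -> uniq r -> 0 <= l -> m <= 1 ->
  exists c, [/\ 0 <= c, c + k t <= \sum_(i <- r) k i &
    forall v, 0 <= v < \sum_(i <- r) k i ->
      ((sample t0 k r v).1 = t /\ l <= (sample t0 k r v).2 < m) <->
      (c + k t * l <= v < c + k t * m)].
Proof.
move=> k0 + + l0 m1; elim: r => // u r IH; rewrite inE big_cons /=.
have rs : 0 <= \sum_(i <- r) k i by apply: sumr_ge0.
case: eqVneq => [-> _ /andP[ur _]|tu /= tr /andP[ur uqr]].
  exists 0; split => //; first by rewrite add0r lerDl.
  move=> v /andP[v0 vs]; rewrite !add0r; case: ltP => [vk|kv] /=.
    have ku : 0 < k u by exact: le_lt_trans vk.
    rewrite ler_pdivlMr// ltr_pdivrMr// ![_ * k u]mulrC.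
    by split => [[]|].
  split.
    case=> E; suff : (sample t0 k r (v - k u)).1 \in r by rewrite E (negPf ur).
    have : 0 <= v - k u < \sum_(i <- r) k i by rewrite subr_ge0 kv ltrBlDl.
    move: (v - k u) => w; clear -k0.
    elim: r w => [|a r IHr] w; first by rewrite big_nil => /andP[/le_lt_trans h /h]; rewrite ltxx.
    rewrite big_cons => /andP[w0 ws] /=; case: ltP => [_|aw] /=; rewrite inE ?eqxx//.
    by rewrite IHr ?orbT// subr_ge0 aw ltrBlDl.
  move=> /andP[_ vm]; exfalso.
  have : v < k u by rewrite (lt_le_trans vm)// ler_piMr.
  by rewrite ltNge kv.
have [c [c0 cs H]] := IH tr uqr.
exists (k u + c); split; first exact: addr_ge0.
  by rewrite -addrA lerD2l.
move=> v /andP[v0 vs]; case: ltP => [vk|kv] /=.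
  split=> [[/esym/eqP]|]; first by rewrite (negPf tu).
  move=> /andP[H1 _]; exfalso; move: vk; rewrite ltNge (le_trans _ H1)//.
  by rewrite -addrA lerDl addr_ge0// mulr_ge0.
rewrite -!addrA -lerBrDl -ltrBlDl; apply: H.
by rewrite subr_ge0 kv ltrBlDl.
Qed.

Lemma word_weight_bounds (R : realType) (T : finType) (k : seq T -> T -> R) g h :
  (forall g t, 0 <= k g t) -> (forall g, \sum_t k g t = 1) ->
  0 <= word_weight k g h <= 1.
Proof.
move=> k0 k1; elim: h g => [|t h IH] g /=; first by rewrite ler01 lexx.
have /andP[w0 w1] := IH (rcons g t); rewrite mulr_ge0//=.
rewrite mulr_ile1// -(k1 g) (bigD1 t)//= lerDl; exact: sumr_ge0.
Qed.

Lemma sample_word_itv (R : realType) (T : finType) (t0 : T)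
    (k : seq T -> T -> R) (g h : seq T) :
  (forall g t, 0 <= k g t) -> (forall g, \sum_t k g t = 1) ->
  exists l, [/\ 0 <= l, l + word_weight k g h <= 1 &
    forall v, 0 <= v < 1 ->
      mkseq (sample_word t0 k g v) (size h) = h <->
      l <= v < l + word_weight k g h].
Proof.
move=> k0 k1; elim: h g => [|t h IH] g /=.
  by exists 0; rewrite add0r; split => // v ->; split.
have [l [l0 l1 H]] := IH (rcons g t).
have sE : \sum_(i <- enum T) k g i = 1 by rewrite big_enum/= k1.
have [c [c0 c1 Hc]] := @sample_itv R T t0 (k g) (enum T) t l _ (k0 g)
  (mem_enum _ _) (enum_uniq _) l0 l1.
have /andP[w0 w1] := word_weight_bounds (rcons g t) h k0 k1.
exists (c + k g t * l); split; first by rewrite addr_ge0// mulr_ge0.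
  rewrite -addrA -mulrDr (le_trans _ (_ : c + k g t <= 1))//; last by rewrite -sE.
  by rewrite lerD2l ler_piMr.
move=> v v01; rewrite -addrA -mulrDr -Hc ?sE//.
have /andP[v0 _] := v01.
have rg := sample_range t0 (enum T) (k0 g) v0.
have -> : mkseq (sample_word t0 k g v) (size h).+1 =
    (sample t0 (k g) (enum T) v).1 ::
    mkseq (sample_word t0 k (rcons g (sample t0 (k g) (enum T) v).1)
             (sample t0 (k g) (enum T) v).2) (size h).
  by rewrite /mkseq /= -[1%N]addn0 iotaDl -map_comp.
move: rg; case: (sample t0 (k g) (enum T) v) => t' r /= rg.
split=> [[-> E]|[-> E]].
  by split=> //; apply/H.
by congr cons; apply/H.
Qed.

Lemma cont_prob_word_weight (R : realType) (S Act : finType) (M : mdp R S Act)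
    (sigma : strategy M) s g h :
  cont_prob sigma s g h =
  word_weight (fun g t => sigma s g t.1 * trans M (hist_last s g) t.1 t.2) g h.
Proof. by elim: h g => //= -[a s'] h IH g; rewrite IH. Qed.

Lemma step_ge0 (R : realType) (S Act : finType) (M : mdp R S Act)
    (sigma : strategy M) s g (t : Act * S) :
  0 <= sigma s g t.1 * trans M (hist_last s g) t.1 t.2.
Proof.
by rewrite mulr_ge0 ?choose_act_ge0//; have /andP[] := trans_bounds M (hist_last s g) t.1 t.2.
Qed.

Lemma step_sum (R : realType) (S Act : finType) (M : mdp R S Act)
    (sigma : strategy M) s g :
  \sum_(t : Act * S) sigma s g t.1 * trans M (hist_last s g) t.1 t.2 = 1.
Proof.
rewrite -(choose_act_sum sigma s g).
rewrite -(pair_bigA _ (fun a s' => sigma s g a * trans M (hist_last s g) a s'))/=.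
apply: eq_bigr => a _; rewrite -mulr_sumr.
have [a0|a0] := leP (sigma s g a) 0.
  have -> : sigma s g a = 0 by apply/eqP; rewrite eq_le a0 choose_act_ge0.
  by rewrite mul0r.
have := choose_act_enabled a0; rewrite inE => /existsP[s' ps'].
have [E|->] := trans_sum M (hist_last s g) a; last by rewrite mulr1.
have ge0 i : true -> 0 <= trans M (hist_last s g) a i.
  by move=> _; have /andP[] := trans_bounds M (hist_last s g) a i.
have := @psumr_eq0P _ _ predT (trans M (hist_last s g) a) ge0 E s' isT.
by move=> e; rewrite e ltxx in ps'.
Qed.

Definition is_path_measure (R : realType) (S Act : finType) (M : mdp R S Act)
    (s : S) (sigma : strategy M) (mu : probability (path_space M) R) : Prop :=
  forall s' h,
    mu (cyl s' h : set (path_space M)) =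
    ((s' == s)%:R * cont_prob sigma s [::] h)%:E.

Definition prob_of (d : measure_display) (T : measurableType d) (R : realType)
    (m : {measure set T -> \bar R}) (m1 : m setT = 1%E) : set T -> \bar R := m.
HB.instance Definition _ (d : measure_display) (T : measurableType d)
    (R : realType) (m : {measure set T -> \bar R}) (m1 : m setT = 1%E) :=
  Measure.copy (prob_of m1) m.
HB.instance Definition _ (d : measure_display) (T : measurableType d)
    (R : realType) (m : {measure set T -> \bar R}) (m1 : m setT = 1%E) :=
  Measure_isProbability.Build _ _ _ (prob_of m1) m1.

Lemma path_measure_exists (R : realType) (S Act : finType) (M : mdp R S Act)
    (s : S) (sigma : strategy M) :
  exists mu : probability (path_space M) R, is_path_measure s sigma mu.
Proof.
pose T := (Act * S)%type : finType.
pose k (g : seq T) (t : T) := sigma s g t.1 * trans M (hist_last s g) t.1 t.2.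
have k0 g t : 0 <= k g t by exact: step_ge0.
have k1 g : \sum_t k g t = 1 by exact: step_sum.
have [a0 _] := trans_live M s; pose t0 : T := (a0, s).
pose I : set R := `[0, 1[%classic.
have mI : measurable (I : set (measurableTypeR R)) by exact: measurable_itv.
pose phi (u : R) : path_space M :=
  (s, sample_word t0 k [::] (if (0 <= u < 1) then u else 0)).
have I0 : 0 <= (0 : R) < 1 by rewrite lexx ltr01.
have phiC h : exists l, [/\ 0 <= l, l + word_weight k [::] h <= 1 &
    forall u, I u -> phi u \in (cyl s h : set (path_space M)) =
      (l <= u < l + word_weight k [::] h)].
  have [l [l0 l1 H]] := @sample_word_itv R T t0 k [::] h k0 k1.
  exists l; split => // u; rewrite /I/= in_itv/= => u01; rewrite /phi u01.
  apply/idP/idP; first by rewrite inE => -[_] /(H _ u01).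
  by move=> /(H _ u01) E; rewrite inE.
have cylN s' h : s' != s -> phi @^-1` (cyl s' h : set (path_space M)) = set0.
  by move=> /eqP ss; apply/seteqP; split => // u [/= E _]; apply: ss.
have phiI u : ~ I u -> phi u = phi 0.
  by rewrite /I/= in_itv/= => /negP/negPf nI; rewrite /phi nI I0.
have mphi : measurable_fun [set: measurableTypeR R] phi.
  apply: (@measurability _ _ (measurableTypeR R) (path_space M) setT phi (@cylinders R S Act M)) => //.
  move=> _ [_ [s' [h ->]] <-]; rewrite setTI.
  have [->|ss] := eqVneq s' s; last by rewrite cylN.
  have [l [l0 l1 H]] := phiC h.
  have -> : phi @^-1` (cyl s h : set (path_space M)) =
      ([set` `[l, (l + word_weight k [::] h)[%R] `&` I) `|`
      (if phi 0 \in (cyl s h : set (path_space M)) then ~` I else set0).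
    apply/seteqP; split => u /=.
      move=> pu; have [Iu|nIu] := pselect (I u).
        by left; split=> //; rewrite in_itv/= -H// inE.
      by right; rewrite -(phiI _ nIu); case: ifPn => //; rewrite notin_setE.
    move=> [[+ Iu]|]; first by rewrite in_itv/= -H// inE.
    case: ifPn => // + nIu; rewrite inE => p0.
    by rewrite (phiI _ nIu).
  apply: measurableU; first by apply: measurableI.
  by case: ifP => // _; exact: measurableC.
pose m0 : {measure set (measurableTypeR R) -> \bar R} :=
  mrestr (@lebesgue_measure R) mI.
pose m : {measure set (path_space M) -> \bar R} :=
  measure_function_pushforward__canonical__measure_function_Measure m0 mphi.
have m1 : m setT = 1%E.
  rewrite /m/= /pushforward preimage_setT /mrestr setTI.
  by rewrite lebesgue_measure_itv/= lte_fin ltr01 oppr0 adde0.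
exists (prob_of m1 : probability _ _) => s' h.
rewrite cont_prob_word_weight -/k.
change (lebesgue_measure (phi @^-1` (cyl s' h : set (path_space M)) `&` I) =
  ((s' == s)%:R * word_weight k [::] h)%:E).
have [->|ss] := eqVneq s' s; last by rewrite cylN// set0I measure0 mul0r.
have [l [l0 l1 H]] := phiC h.
have -> : phi @^-1` (cyl s h : set (path_space M)) `&` I =
    [set` `[l, (l + word_weight k [::] h)[%R].
  apply/seteqP; split => u /=.
    by move=> [pu Iu]; rewrite in_itv/= -H// inE.
  rewrite in_itv/= => lu.
  have Iu : I u.
    move: lu => /andP[lu ul]; rewrite /I/= in_itv/= (le_trans l0 lu)/=.
    exact: lt_le_trans l1.
  by split=> //; move: lu; rewrite -H// inE.
have /andP[w0 _] := word_weight_bounds [::] h k0 k1.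
rewrite lebesgue_measure_itv/= lte_fin mul1r ltrDl.
case: ltP => [_|w0']; first by rewrite -EFinB addrAC subrr add0r.
by congr EFin; apply/eqP; rewrite eq_le w0.
Qed.

Lemma path_measure_unique (R : realType) (S Act : finType) (M : mdp R S Act)
    (s : S) (sigma : strategy M) (mu nu : probability (path_space M) R) :
  is_path_measure s sigma mu -> is_path_measure s sigma nu ->
  forall A : set (path_space M), measurable A -> mu A = nu A.
Proof.
move=> hmu hnu.
pose G : set (set (path_space M)) :=
  [set C | [\/ @cylinders R S Act M C, C = set0 | C = setT]].
have cG : @cylinders R S Act M `<=` G by move=> C; constructor 1.
suff uG A : <<s G >> A -> mu A = nu A.
  move=> A mA; apply: uG; exact: (sub_sigma_algebra2 cG) mA.
move: A; apply: (@g_sigma_algebra_measure_unique _ R (path_space M) G _ (fun=> setT)).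
- move=> C [cC|->|->]; [exact: sub_sigma_algebra|exact: measurable0|exact: measurableT].
- by move=> _; constructor 3.
- by apply/seteqP; split => // x _; exists 0%N.
- move=> A B [cA|->|->] [cB|->|->]; rewrite ?(setI0, set0I, setTI, setIT);
    try by [constructor 2|constructor 3|constructor 1].
  move: cA cB => [s1 [h1 ->]] [s2 [h2 ->]].
  wlog le : s1 s2 h1 h2 / (size h1 <= size h2)%N.
    move=> W; have [/W//|/ltnW/W] := leqP (size h1) (size h2).
    by rewrite setIC.
  have tk (p : ipath M) : mkseq p.2 (size h2) = h2 -> mkseq p.2 (size h1) = take (size h1) h2.
    by move=> <-; rewrite /mkseq -map_take take_iota (minn_idPl le).
  have [[-> E]|N] := pselect (s1 = s2 /\ take (size h1) h2 = h1).
    constructor 1; exists s2, h2; apply/seteqP; split => p; first by case.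
    by move=> [p1 p2]; split; split => //; rewrite tk.
  constructor 2; apply/seteqP; split => // p [[p1 p2] [p3 p4]]; apply: N.
  by split; [rewrite -p1|rewrite -(tk p p4)].
- move=> A [[s' [h ->]]|->|->]; first exact: etrans (hmu s' h) (esym (hnu s' h)).
  + by rewrite !measure0.
  + exact: etrans (probability_setT mu) (esym (probability_setT nu)).
- by move=> _ /=; rewrite probability_setT ltry.
Qed.

Definition path_prob (R : realType) (S Act : finType) (M : mdp R S Act)
    (s : S) (sigma : strategy M) : probability (path_space M) R :=
  projT1 (cid (path_measure_exists s sigma)).

Lemma path_probP (R : realType) (S Act : finType) (M : mdp R S Act)
    (s : S) (sigma : strategy M) : is_path_measure s sigma (path_prob s sigma).
Proof. exact: projT2 (cid (path_measure_exists s sigma)). Qed.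

(* The sum of f i over i < n, where n is the least index with
   pstate p n \in G, and n = oo if G is never visited. *)
Definition sum_until (R : realType) (S Act : finType) (M : mdp R S Act)
    (G : {set S}) (f : nat -> R) (p : ipath M) : \bar R :=
  match pselect (exists n, pstate p n \in G) with
  | left hit => (\sum_(0 <= i < ex_minn hit) (f i)%:E)%E
  | right _ => (\sum_(0 <= i <oo) (f i)%:E)%E
  end.

Definition reward_until (R : realType) (S Act : finType) (M : mdp R S Act)
    (rew : S -> Act -> S -> R) (G : {set S}) (p : ipath M) : \bar R :=
  sum_until G (fun i => rew (pstate p i) (paction p i) (pstate p i.+1)) p.

Definition visits_until (R : realType) (S Act : finType) (M : mdp R S Act)
    (s : S) (G : {set S}) (p : ipath M) : \bar R :=
  sum_until G (fun i => (pstate p i == s)%:R) p.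

Inductive cmp := CmpGe | CmpLe.

Definition cmp_holds (d : Order.disp_t) (T : porderType d) (c : cmp) (x y : T)
    : bool :=
  match c with CmpGe => (x >= y)%O | CmpLe => (x <= y)%O end.

Definition cmp_eps (R : realType) (c : cmp) : R :=
  match c with CmpGe => 1 | CmpLe => -1 end.

Definition cmp_mu (R : realType) (c : cmp) : R :=
  match c with CmpGe => 0 | CmpLe => 1 end.

Record objective (R : realType) (S Act : finType) := Objective {
  obj_cmp : cmp;
  obj_rew : S -> Act -> S -> R;
  obj_rew_ge0 : forall s a s', 0 <= obj_rew s a s';
  obj_goal : {set S}
}.

Definition query (R : realType) (S Act : finType) (l : nat) :=
  'I_l -> objective R S Act.

Definition exp_reward (R : realType) (S Act : finType) (M : mdp R S Act)
    (s : S) (sigma : strategy M) (psi : objective R S Act) : \bar R :=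
  (\int[path_prob s sigma]_p
     reward_until (M := M) (obj_rew psi) (obj_goal psi) p)%E.

Definition achieves (R : realType) (S Act : finType) (M : mdp R S Act)
    (l : nat) (Q : query R S Act l) (sigma : strategy M) (p : 'rV[R]_l) : Prop :=
  forall j, cmp_holds (obj_cmp (Q j))
    (exp_reward (init M) sigma (Q j)) (p ord0 j)%:E.

Definition Ach_PS (R : realType) (S Act : finType) (M : mdp R S Act)
    (l : nat) (Q : query R S Act l) : set 'rV[R]_l :=
  [set p | exists sigma : ps_strategy M, achieves Q sigma p].

Definition states_of (S Act : finType) (E : {set S * Act}) : {set S} :=
  [set s | [exists a, (s, a) \in E]].

Definition closed_sub (R : realType) (S Act : finType) (M : mdp R S Act)
    (E : {set S * Act}) : bool :=
  [forall sa in E, (sa.2 \in enabled M sa.1) &&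
                   (succs M sa.1 sa.2 \subset states_of E)].

Definition step_in (R : realType) (S Act : finType) (M : mdp R S Act)
    (E : {set S * Act}) : rel S :=
  [rel s t | [exists a, ((s, a) \in E) && (t \in succs M s a)]].

Definition is_ec (R : realType) (S Act : finType) (M : mdp R S Act)
    (E : {set S * Act}) : bool :=
  [&& E != finset.set0, closed_sub M E &
      [forall s in states_of E, forall t in states_of E,
         connect (step_in M E) s t]].

(* inl s : a state of the end component; inr true : the fresh initial state;
   inr false : the sink. *)
Definition ec_state (S Act : finType) (E : {set S * Act}) : finType :=
  ({s : S | s \in states_of E} + bool)%type.

(* inl a : an original action; inr true : the initial action; inr false : the
   stopping action. *)
Definition ec_action (Act : finType) : finType := (Act + bool)%type.

Definition ec_init (S Act : finType) (E : {set S * Act}) : ec_state E :=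
  inr true.

Definition ec_sink (S Act : finType) (E : {set S * Act}) : ec_state E :=
  inr false.

Definition ec_trans (R : realType) (S Act : finType) (M : mdp R S Act)
    (E : {set S * Act}) (x : ec_state E) (b : ec_action Act) (y : ec_state E)
    : R :=
  match x, b, y with
  | inl s, inl a, inl t =>
      if (val s, a) \in E then trans M (val s) a (val t) else 0
  | inl s, inl a, inr false =>
      ((a \in enabled M (val s)) && ((val s, a) \notin E))%:R
  | inl _, inr false, inr false => 1
  | inr true, inr true, inl _ => #|states_of E|%:R^-1
  | inr false, inr false, inr false => 1
  | _, _, _ => 0
  end.

Lemma ec_trans_ge0 (R : realType) (S Act : finType) (M : mdp R S Act)
    (E : {set S * Act}) x b y : 0 <= @ec_trans R S Act M E x b y.
Proof.
case: x b y => [s|[]] [a|[]] [t|[]] //=; rewrite ?ler01 ?ler0n ?invr_ge0//.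
by case: ifP => // _; have /andP[] := trans_bounds M (val s) a (val t).
Qed.

Lemma ec_trans_sum (R : realType) (S Act : finType) (M : mdp R S Act)
    (E : {set S * Act}) (ecE : is_ec M E) x b :
  \sum_y @ec_trans R S Act M E x b y = 0 \/
  \sum_y @ec_trans R S Act M E x b y = 1.
Proof.
have /and3P[E0 cE _] := ecE.
rewrite big_sumType/= big_bool/=.
case: x b => [s|[]] [a|[]] /=.
- rewrite add0r; have [sE|sE] := boolP ((val s, a) \in E); last first.
    rewrite big1// add0r andbT.
    by case: (a \in _); [right|left].
  rewrite andbF addr0.
  have /forall_inP/(_ _ sE)/andP[/= aen /fintype.subsetP sub] := cE.
  have -> : \sum_(i : {s | s \in states_of E}) trans M (val s) a (val i) =
            \sum_i trans M (val s) a i.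
    rewrite [RHS](bigID (mem (states_of E)))/= [X in _ + X]big1 ?addr0.
      exact: esym (big_sub _ _).
    move=> i niE; apply/eqP; apply: contraNT niE => ni.
    have /andP[p0 _] := trans_bounds M (val s) a i.
    by apply: sub; rewrite inE lt_neqAle eq_sym ni.
  exact: trans_sum.
- by left; rewrite big1// !addr0.
- by right; rewrite big1// !add0r.
- by left; rewrite big1// !addr0.
- right; rewrite !addr0 sumr_const card_sig.
  rewrite (_ : #|[pred x | x \in states_of E]| = #|states_of E|); last exact: eq_card.
  rewrite -[X in X = _]mulr_natr mulVf// pnatr_eq0.
  have /set0Pn[[s a] sa] := E0.
  by rewrite cards_eq0; apply/set0Pn; exists s; rewrite inE; apply/existsP; exists a.
- by left; rewrite big1// !addr0.
- by left; rewrite big1// !addr0.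
- by left; rewrite big1// !addr0.
- by right; rewrite big1// !add0r.
Qed.

Lemma ec_trans_bounds (R : realType) (S Act : finType) (M : mdp R S Act)
    (E : {set S * Act}) (ecE : is_ec M E) x b y :
  0 <= @ec_trans R S Act M E x b y <= 1.
Proof.
rewrite ec_trans_ge0/=.
have : ec_trans M x b y <= \sum_z ec_trans M x b z.
  by rewrite (bigD1 y)//= lerDl; apply: sumr_ge0 => z _; exact: ec_trans_ge0.
by case: (ec_trans_sum ecE x b) => -> // /le_trans; apply.
Qed.

Lemma ec_trans_live (R : realType) (S Act : finType) (M : mdp R S Act)
    (E : {set S * Act}) (ecE : is_ec M E) x :
  exists b y, 0 < @ec_trans R S Act M E x b y.
Proof.
case: x => [s|[]].
- by exists (inr false), (inr false) => /=.
- have /and3P[/set0Pn[[s a] sa] _ _] := ecE.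
  have sE : s \in states_of E by rewrite inE; apply/existsP; exists a.
  exists (inr true), (inl (exist _ s sE)) => /=.
  by rewrite invr_gt0 ltr0n card_gt0; apply/set0Pn; exists s.
- by exists (inr false), (inr false) => /=.
Qed.

Definition ec_mdp (R : realType) (S Act : finType) (M : mdp R S Act)
    (E : {set S * Act}) (ecE : is_ec M E) : mdp R (ec_state E) (ec_action Act) :=
  MDP (ec_init E) (ec_trans_bounds ecE) (ec_trans_sum ecE) (ec_trans_live ecE).

Definition ec_reaches_sink (R : realType) (S Act : finType) (M : mdp R S Act)
    (E : {set S * Act}) (ecE : is_ec M E) (sigma : ps_strategy (ec_mdp ecE))
    : Prop :=
  path_prob (init (ec_mdp ecE)) sigma
    [set p : path_space (ec_mdp ecE) |
       exists n, pstate (M := ec_mdp ecE) p n = ec_sink E] = 1%E.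

Definition ec_exp_visits (R : realType) (S Act : finType) (M : mdp R S Act)
    (E : {set S * Act}) (ecE : is_ec M E) (sigma : ps_strategy (ec_mdp ecE))
    (s : {s : S | s \in states_of E}) : \bar R :=
  (\int[path_prob (init (ec_mdp ecE)) sigma]_p
     visits_until (M := ec_mdp ecE) (inl s) [set ec_sink E]%SET p)%E.

Definition S_zero (R : realType) (S Act : finType) (M : mdp R S Act)
    (psi : objective R S Act) : {set S} :=
  finset (fun s => `[< forall sigma : strategy M, exp_reward s sigma psi = 0%E >]).

Definition step_avoiding (R : realType) (S Act : finType) (M : mdp R S Act)
    (Z : {set S}) : rel S :=
  [rel s t | [&& s \notin Z, t \notin Z & [exists a, t \in succs M s a]]].

Definition S_maybe (R : realType) (S Act : finType) (M : mdp R S Act)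
    (psi : objective R S Act) : {set S} :=
  finset (fun s => (s \notin S_zero M psi) &&
    connect (step_avoiding M (S_zero M psi)) (init M) s).

(* Closed sets are stable under union, so this is the largest closed subset
   of S_maybe x Act. *)
Definition E_maybe (R : realType) (S Act : finType) (M : mdp R S Act)
    (psi : objective R S Act) : {set S * Act} :=
  \bigcup_(E : {set S * Act} |
      closed_sub M E && (E \subset finset.setX (S_maybe M psi) finset.setT)) E.

Definition is_mec (R : realType) (S Act : finType) (M : mdp R S Act)
    (psi : objective R S Act) (E : {set S * Act}) : bool :=
  maxset (fun F => is_ec M F && (F \subset E_maybe M psi)) E.

(* Variables are total functions; each is constrained only at the indices at
   which it occurs in the system. *)

Record C1 (R : realType) (S Act : finType) (M : mdp R S Act) (l : nat)
    (Q : query R S Act l) (p : 'rV[R]_l) (U : 'I_l -> S -> rat)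
    (a : S -> Act -> R) (x : 'I_l -> S -> R) (xa : 'I_l -> S -> Act -> R)
    : Prop := {
  C1_a_bin : forall s b, b \in enabled M s -> a s b = 0 \/ a s b = 1;
  C1_a_sum : forall s, \sum_(b in enabled M s) a s b = 1;
  C1_x_zero : forall j s, s \in S_zero M (Q j) -> x j s = 0;
  C1_x_bounds : forall j s, s \in S_maybe M (Q j) ->
    0 <= cmp_eps R (obj_cmp (Q j)) * x j s <= ratr (U j s);
  C1_xa_bounds : forall j s b, s \in S_maybe M (Q j) -> b \in enabled M s ->
    0 <= cmp_eps R (obj_cmp (Q j)) * xa j s b <= ratr (U j s);
  C1_xa_step : forall j s b, s \in S_maybe M (Q j) -> b \in enabled M s ->
    xa j s b <= \sum_s' trans M s b s' *
      (x j s' + cmp_eps R (obj_cmp (Q j)) * obj_rew (Q j) s b s');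
  C1_xa_choice : forall j s b, s \in S_maybe M (Q j) -> b \in enabled M s ->
    xa j s b <= ratr (U j s) * (a s b - cmp_mu R (obj_cmp (Q j)));
  C1_x_choice : forall j s, s \in S_maybe M (Q j) ->
    x j s <= \sum_(b in enabled M s) xa j s b +
      cmp_mu R (obj_cmp (Q j)) * (#|enabled M s|%:R - 1) * ratr (U j s);
  C1_point : forall j,
    cmp_holds (obj_cmp (Q j)) (cmp_eps R (obj_cmp (Q j)) * x j (init M))
      (p ord0 j)
}.

(* zb j s is the variable z^j_{s,bot}. *)
Record C3 (R : realType) (S Act : finType) (M : mdp R S Act) (l : nat)
    (Q : query R S Act l) (U : 'I_l -> S -> rat)
    (X : {set S * Act} -> S -> rat)
    (a : S -> Act -> R) (x : 'I_l -> S -> R)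
    (e : 'I_l -> S -> R) (ea : 'I_l -> S -> Act -> R)
    (z : 'I_l -> S -> Act -> R) (zb : 'I_l -> S -> R) : Prop := {
  C3_e_bin : forall j E s, is_mec M (Q j) E -> s \in states_of E ->
    e j s = 0 \/ e j s = 1;
  C3_x_e : forall j E s, is_mec M (Q j) E -> s \in states_of E ->
    cmp_eps R (obj_cmp (Q j)) * x j s <= ratr (U j s) * (1 - e j s);
  C3_ea_bin : forall j E s b, is_mec M (Q j) E -> (s, b) \in E ->
    ea j s b = 0 \/ ea j s b = 1;
  C3_ea_a : forall j E s b, is_mec M (Q j) E -> (s, b) \in E ->
    ea j s b <= a s b;
  C3_ea_succ : forall j E s b s', is_mec M (Q j) E -> (s, b) \in E ->
    s' \in succs M s b -> ea j s b <= e j s';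
  C3_e_sum : forall j E s, is_mec M (Q j) E -> s \in states_of E ->
    e j s = \sum_(b | (s, b) \in E) ea j s b;
  C3_z_bounds : forall j E s b, is_mec M (Q j) E -> s \in states_of E ->
    b \in enabled M s -> 0 <= z j s b <= ratr (X E s) * a s b;
  C3_zb_bounds : forall j E s, is_mec M (Q j) E -> s \in states_of E ->
    0 <= zb j s <= ratr (X E s) * e j s;
  C3_flow : forall j E s, is_mec M (Q j) E -> s \in states_of E ->
    zb j s + \sum_(b in enabled M s) z j s b =
    #|states_of E|%:R^-1 +
      \sum_(sb in pres M s :&: E) trans M sb.1 sb.2 s * z j sb.1 sb.2;
  C3_exit : forall j E, is_mec M (Q j) E ->
    1 = \sum_(s in states_of E)
          (zb j s + \sum_(b in enabled M s | (s, b) \notin E) z j s b)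
}.

(* Main.v *)
Require Import Defs.
From HB Require Import structures.
From mathcomp Require Import all_boot all_order all_algebra.
From mathcomp Require Import all_classical all_reals all_analysis.
From mathcomp Require Import measurable_realfun.

(** Under a pure stationary strategy the expected rewards [V] solve the
    first-step equations and lie below every nonnegative supersolution of them.

    A solution of C1 selects a strategy through the binary variables [a]. For
    [<=], [- x] is a supersolution, so it bounds [V] from above. For [>=],
    [x - V] is subharmonic; if its maximum over [S_maybe] were positive, the
    set of maximizers would be closed under the strategy and would contain a
    bottom strongly connected component, lying in some maximal end component.
    The flow [z] of C3 cannot leave that component, so it is stopped at one of
    its states; there [e = 1] and hence [x <= 0], a contradiction.

    Conversely, given a strategy, take [x = V] up to sign, stop in the states of
    value 0 from which the strategy never leaves the end component, and let [z]
    be the expected numbers of visits before the sink of [ec_mdp]. The sink is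
    reached almost surely: a closed set without stopping states would have
    positive, finite value everywhere, whereas at its states of least value the
    reward, hence the value, is 0. The inequality of C1 for actions not chosen
    when the comparison is [<=] is the bound [U] for the history-dependent
    strategy that takes such an action once. *)

Set Implicit Arguments.
Unset Strict Implicit.
Unset Printing Implicit Defensive.
Import Order.TTheory GRing.Theory Num.Theory.
Local Open Scope classical_set_scope.
Local Open Scope ring_scope.

(** * Expected rewards as series over finite histories *)

Lemma sum_tupleS (V : nmodType) (T : finType) (n : nat)
    (F : seq T -> V) :
  \sum_(h : n.+1.-tuple T) F h = \sum_t \sum_(h : n.-tuple T) F (t :: h).
Proof.
rewrite pair_bigA /=.
rewrite (reindex (fun th : T * n.-tuple T => [tuple of th.1 :: th.2])) //=.
exists (fun h : n.+1.-tuple T => (thead h, [tuple of behead h])).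
  by move=> [t h] _; congr pair; apply/val_inj.
by move=> h _; apply/val_inj => /=; case/tupleP: h.
Qed.

Lemma measurable_cyl (R : realType) (S Act : finType) (M : mdp R S Act) s h :
  measurable (cyl s h : set (path_space M)).
Proof. by apply: sub_sigma_algebra; exists s, h. Qed.

(** The cylinders of words of length [n] partition the path space, so a function of the first [n]
    letters is a finite combination of indicators. This gives its measurability and its integral. *)
Lemma word_fun_indic (R : realType) (S Act : finType) (M : mdp R S Act)
    (n : nat) (F : S -> seq (Act * S) -> R) (p : path_space M) :
  (F p.1 (mkseq p.2 n))%:E = (\sum_(sh : S * n.-tuple (Act * S))
    (F sh.1 sh.2)%:E * (\1_(cyl sh.1 sh.2 : set (path_space M)) p)%:E)%E.
Proof.
have sz : size (mkseq p.2 n) == n by rewrite size_mkseq.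
rewrite (bigD1 (p.1, Tuple sz))//= indicE mem_set; last first.
  by split => //=; rewrite size_mkseq.
rewrite mule1 big1 ?adde0// => -[s h] /= ne.
rewrite indicE memNset ?mule0// => -[/= E1 E2]; move/negP: ne; apply.
by apply/eqP; congr pair => //; apply/val_inj; rewrite /= -E2 size_tuple.
Qed.

Lemma measurable_word_fun (R : realType) (S Act : finType) (M : mdp R S Act)
    (n : nat) (F : S -> seq (Act * S) -> R) :
  measurable_fun [set: path_space M]
    (fun p => (F p.1 (mkseq p.2 n))%:E : \bar R).
Proof.
under eq_fun do rewrite word_fun_indic.
apply: emeasurable_sum => -[s h] /=.
apply: emeasurable_funM; first exact: measurable_cst.
by apply/measurable_EFinP; apply: measurable_indic; exact: measurable_cyl.
Qed.

Lemma integral_word_fun (R : realType) (S Act : finType) (M : mdp R S Act)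
    (s : S) (sigma : strategy M) (n : nat) (F : S -> seq (Act * S) -> R) :
  (forall s h, 0 <= F s h) ->
  (\int[path_prob s sigma]_p (F p.1 (mkseq p.2 n))%:E)%E =
  (\sum_(h : n.-tuple (Act * S)) cont_prob sigma s [::] h * F s h)%:E.
Proof.
move=> F0; under eq_integral do rewrite word_fun_indic.
rewrite ge0_integral_sum//; last 2 first.
- move=> [s' h] /=; apply: emeasurable_funM; first exact: measurable_cst.
  by apply/measurable_EFinP; apply: measurable_indic; exact: measurable_cyl.
- by move=> [s' h] p _ /=; rewrite mule_ge0// lee_fin.
rewrite (eq_bigr (fun sh : S * n.-tuple (Act * S) => (F sh.1 sh.2 *
    ((sh.1 == s)%:R * cont_prob sigma s [::] sh.2))%:E)); last first.
  move=> [s' h] _ /=; rewrite ge0_integralZl_EFin//; last first.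
    by apply/measurable_EFinP; apply: measurable_indic; exact: measurable_cyl.
  rewrite integral_indic//; last exact: measurable_cyl.
  by rewrite setIT EFinM; congr (_ * _)%E; exact: path_probP.
rewrite sumEFin; congr EFin.
rewrite -(pair_bigA _ (fun s' (h : n.-tuple _) =>
  F s' h * ((s' == s)%:R * cont_prob sigma s [::] h)))/=.
rewrite (bigD1 s)//= [X in _ + X]big1 ?addr0.
  by apply: eq_bigr => h _; rewrite eqxx mul1r mulrC.
by move=> s' /negPf ss; rewrite big1// => h _; rewrite ss mul0r mulr0.
Qed.

(* The reward of the last transition of the history [(s, h)], or 0 if [G] is
   visited before it. *)
Fixpoint last_rew (R : realType) (S Act : finType) (rew : S -> Act -> S -> R)
    (G : {set S}) (s : S) (h : seq (Act * S)) : R :=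
  if h is t :: h' then
    if s \in G then 0
    else if h' is [::] then rew s t.1 t.2 else last_rew rew G t.2 h'
  else 0.

Lemma last_rew_ge0 (R : realType) (S Act : finType) (rew : S -> Act -> S -> R)
    (G : {set S}) s h :
  (forall s a s', 0 <= rew s a s') -> 0 <= last_rew rew G s h.
Proof.
move=> r0; elim: h s => //= t h IH s; case: ifP => // _.
by case: h IH => // u h IH; exact: IH.
Qed.

Lemma last_rew_mkseq (R : realType) (S Act : finType) (M : mdp R S Act)
    (rew : S -> Act -> S -> R) (G : {set S}) (p : ipath M) i :
  last_rew rew G p.1 (mkseq p.2 i.+1) =
  if [forall k : 'I_i.+1, pstate p k \notin G]
  then rew (pstate p i) (paction p i) (pstate p i.+1) else 0.
Proof.
elim: i p => [|i IH] p.
  rewrite /=; case: ifPn => pG.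
    by case: forallP => // /(_ ord0); rewrite /= pG.
  by case: forallP => // -[] k; rewrite (ord1 k).
(* [q] is the path without its first transition. *)
pose q : ipath M := ((p.2 0%N).2, fun k => p.2 k.+1).
have -> : mkseq p.2 i.+2 = p.2 0%N :: mkseq q.2 i.+1.
  by rewrite /mkseq /= -[2%N]addn1 -[1%N]addn0 !iotaDl -!map_comp.
have -> : last_rew rew G p.1 (p.2 0%N :: mkseq q.2 i.+1) =
    if p.1 \in G then 0 else last_rew rew G q.1 (mkseq q.2 i.+1) by [].
rewrite IH; case: ifPn => pG.
  by case: forallP => // /(_ ord0); rewrite /= pG.
have -> : [forall k : 'I_i.+2, pstate p k \notin G] =
    [forall k : 'I_i.+1, pstate q k \notin G].
  apply/forallP/forallP => H k.
    by have := H (lift ord0 k); rewrite /q /=; case: k => -[].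
  by case: (unliftP ord0 k) => [j ->|-> //]; have := H j; case: j => -[].
by case: ifP => // _; rewrite /q; case: i {IH}.
Qed.

(** The stopping rule moves from the upper limit of the sum into the summands, which vanish from the
    hitting time on. Each summand then depends on a finite prefix only and can be integrated. *)
Lemma reward_until_series (R : realType) (S Act : finType) (M : mdp R S Act)
    (rew : S -> Act -> S -> R) (G : {set S}) (p : ipath M) :
  (forall s a s', 0 <= rew s a s') ->
  reward_until rew G p =
  (\sum_(0 <= i <oo) (last_rew rew G p.1 (mkseq p.2 i.+1))%:E)%E.
Proof.
move=> r0; rewrite /reward_until /sum_until; case: pselect => hit; last first.
  apply: eq_eseriesr => i _; rewrite last_rew_mkseq; case: forallP => // -[] k.
  by apply/negP => kG; apply: hit; exists k.
case: ex_minnP => n nG nmin.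
rewrite (nneseries_split 0 n); last by move=> k _; rewrite lee_fin last_rew_ge0.
rewrite add0n [X in (_ + X)%E]eseries0 ?adde0; last first.
  move=> i ni _; rewrite last_rew_mkseq.
  by case: forallP => // /(_ (Ordinal (n:=i.+1) (m:=n) ni))/=; rewrite nG.
rewrite big_nat [RHS]big_nat; apply: eq_bigr => i /andP[_ ilt].
rewrite last_rew_mkseq; case: forallP => // -[] k; apply/negP => kG.
by move: (leq_trans ilt (nmin _ kG)); rewrite leqNgt ltn_ord.
Qed.

(** The expected reward of transition [i] before [G] is visited, starting in [s]. Transitions are
    counted from 0, hence the words of length [i.+1]. *)
Definition rew_at (R : realType) (S Act : finType) (M : mdp R S Act)
    (psi : objective R S Act) (sigma : strategy M) (i : nat) (s : S) : R :=
  \sum_(h : i.+1.-tuple (Act * S))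
    cont_prob sigma s [::] h * last_rew (obj_rew psi) (obj_goal psi) s h.

Lemma cont_prob_ge0 (R : realType) (S Act : finType) (M : mdp R S Act)
    (sigma : strategy M) s g h : 0 <= cont_prob sigma s g h.
Proof.
rewrite cont_prob_word_weight.
by have /andP[] := word_weight_bounds g h (step_ge0 sigma s) (step_sum sigma s).
Qed.

Lemma rew_at_ge0 (R : realType) (S Act : finType) (M : mdp R S Act)
    (psi : objective R S Act) (sigma : strategy M) i s :
  0 <= rew_at psi sigma i s.
Proof.
apply: sumr_ge0 => h _.
by rewrite mulr_ge0 ?cont_prob_ge0 ?last_rew_ge0//; exact: obj_rew_ge0.
Qed.

(** Monotone convergence exchanges the integral and the series of nonnegative terms. *)
Lemma exp_reward_series (R : realType) (S Act : finType) (M : mdp R S Act)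
    (psi : objective R S Act) (sigma : strategy M) s :
  exp_reward s sigma psi = (\sum_(0 <= i <oo) (rew_at psi sigma i s)%:E)%E.
Proof.
have r0 := @obj_rew_ge0 _ _ _ psi.
rewrite /exp_reward.
under eq_integral do rewrite reward_until_series//.
rewrite (@integral_nneseries _ (path_space M) R (path_prob s sigma) setT
  measurableT (fun i p =>
    (last_rew (obj_rew psi) (obj_goal psi) p.1 (mkseq p.2 i.+1))%:E)).
- apply: eq_eseriesr => i _.
  rewrite (integral_word_fun _ _ _ (F := last_rew (obj_rew psi) (obj_goal psi)))//.
  by move=> *; exact: last_rew_ge0.
- by move=> i; exact: (measurable_word_fun _ (last_rew (obj_rew psi) (obj_goal psi))).
- by move=> i p _; rewrite lee_fin last_rew_ge0.
Qed.

Lemma exp_reward_ge0 (R : realType) (S Act : finType) (M : mdp R S Act)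
    (psi : objective R S Act) (sigma : strategy M) s :
  (0 <= exp_reward s sigma psi)%E.
Proof.
by rewrite exp_reward_series; apply: nneseries_ge0 => i _ _; rewrite lee_fin rew_at_ge0.
Qed.

(** * First-step equations and supersolutions *)

Lemma rew_at_goal (R : realType) (S Act : finType) (M : mdp R S Act)
    (psi : objective R S Act) (sigma : strategy M) i s :
  s \in obj_goal psi -> rew_at psi sigma i s = 0.
Proof.
move=> sG; rewrite /rew_at big1// => h _; case/tupleP: h => t h /=.
by rewrite sG mulr0.
Qed.

Lemma exp_reward_goal (R : realType) (S Act : finType) (M : mdp R S Act)
    (psi : objective R S Act) (sigma : strategy M) s :
  s \in obj_goal psi -> exp_reward s sigma psi = 0%E.
Proof.
by move=> sG; rewrite exp_reward_series eseries0// => i _ _; rewrite rew_at_goal.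
Qed.

Lemma rew_at0 (R : realType) (S Act : finType) (M : mdp R S Act)
    (psi : objective R S Act) (tau : strategy M) s :
  s \notin obj_goal psi ->
  rew_at psi tau 0 s = \sum_(t : Act * S)
    tau s [::] t.1 * trans M s t.1 t.2 * obj_rew psi s t.1 t.2.
Proof.
move=> sG; rewrite /rew_at (sum_tupleS 0 (fun h => cont_prob tau s [::] h *
  last_rew (obj_rew psi) (obj_goal psi) s h)).
apply: eq_bigr => t _; rewrite (bigD1 [tuple])//= big1 ?addr0; last first.
  by move=> h /eqP[]; rewrite (tuple0 h).
by case: t => a s'; rewrite (negPf sG) mulr1.
Qed.

(** The premise on [cont_prob] says that after one step [tau] behaves like [sigma] started afresh.
    It covers a stationary strategy, with [tau = sigma], as well as a deviation from [sigma] in the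
    first step. *)
Lemma rew_atS (R : realType) (S Act : finType) (M : mdp R S Act)
    (psi : objective R S Act) (tau sigma : strategy M) i s :
  (forall t h, cont_prob tau s [:: t] h = cont_prob sigma t.2 [::] h) ->
  s \notin obj_goal psi ->
  rew_at psi tau i.+1 s = \sum_(t : Act * S)
    tau s [::] t.1 * trans M s t.1 t.2 * rew_at psi sigma i t.2.
Proof.
move=> shift sG; rewrite /rew_at (sum_tupleS _ (fun h => cont_prob tau s [::] h *
  last_rew (obj_rew psi) (obj_goal psi) s h)).
apply: eq_bigr => t _; rewrite mulr_sumr; apply: eq_bigr => h _.
case: t => a s'; rewrite [cont_prob _ _ _ (_ :: _)]/= shift -!mulrA.
by case/tupleP: h => u h /=; rewrite (negPf sG).
Qed.

Lemma exp_reward_first_step (R : realType) (S Act : finType) (M : mdp R S Act)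
    (psi : objective R S Act) (tau sigma : strategy M) s :
  (forall t h, cont_prob tau s [:: t] h = cont_prob sigma t.2 [::] h) ->
  s \notin obj_goal psi ->
  exp_reward s tau psi = (\sum_(t : Act * S)
    (tau s [::] t.1 * trans M s t.1 t.2)%:E *
    ((obj_rew psi s t.1 t.2)%:E + exp_reward t.2 sigma psi))%E.
Proof.
move=> shift sG; have k0 := step_ge0 tau s [::].
rewrite exp_reward_series nneseries_recl//; last first.
  by move=> i _; rewrite lee_fin rew_at_ge0.
rewrite -nneseries_addn; last by move=> i; rewrite lee_fin rew_at_ge0.
rewrite rew_at0// -sumEFin.
under eq_eseriesr do rewrite addn1 (rew_atS _ shift sG) -sumEFin.
rewrite nneseries_sum; last first.
  by move=> t i _; rewrite lee_fin mulr_ge0 ?rew_at_ge0//; exact: k0.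
rewrite -big_split/=; apply: eq_bigr => t _.
rewrite ge0_muleDr ?lee_fin ?obj_rew_ge0 ?exp_reward_ge0//.
rewrite EFinM; congr (_ + _)%E; rewrite exp_reward_series -nneseriesZl//.
by move=> i _; rewrite lee_fin rew_at_ge0.
Qed.

Lemma trans_ge0 (R : realType) (S Act : finType) (M : mdp R S Act) s b s' :
  0 <= trans M s b s'.
Proof. by have /andP[] := trans_bounds M s b s'. Qed.

Lemma trans_sum1 (R : realType) (S Act : finType) (M : mdp R S Act) s b :
  b \in enabled M s -> \sum_s' trans M s b s' = 1.
Proof.
rewrite inE => /existsP[t pt].
have [E|//] := trans_sum M s b.
have ge0 i : true -> 0 <= trans M s b i by move=> _; exact: trans_ge0.
have e := @psumr_eq0P _ _ predT (trans M s b) ge0 E t isT.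
by rewrite e ltxx in pt.
Qed.

Lemma trans_eq0 (R : realType) (S Act : finType) (M : mdp R S Act) s b s' :
  s' \notin succs M s b -> trans M s b s' = 0.
Proof.
by rewrite inE -leNgt => h; apply/eqP; rewrite eq_le h trans_ge0.
Qed.

Lemma cont_prob_ps (R : realType) (S Act : finType) (M : mdp R S Act)
    (sigma : ps_strategy M) s g s' g' h :
  hist_last s g = hist_last s' g' ->
  cont_prob sigma s g h = cont_prob sigma s' g' h.
Proof.
elim: h s g s' g' => // -[a u] h IH s g s' g' E /=.
rewrite (IH s (rcons g (a, u)) s' (rcons g' (a, u))); last first.
  by rewrite /hist_last !map_rcons !last_rcons.
by rewrite /ps_choose E.
Qed.

Lemma sum_act_state (S Act : finType) (V : nmodType)
    (b : Act) (F : Act * S -> V) :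
  (forall t, t.1 != b -> F t = 0) -> \sum_t F t = \sum_s F (b, s).
Proof.
move=> F0; rewrite (eq_bigr (fun t => F (t.1, t.2))); last by case.
rewrite -(pair_bigA _ (fun a s => F (a, s)))/= (bigD1 b)//=.
rewrite [X in _ + X]big1 ?addr0// => a ab; rewrite big1// => s _.
exact: F0.
Qed.

Lemma rew_at_ps0 (R : realType) (S Act : finType) (M : mdp R S Act)
    (psi : objective R S Act) (sigma : ps_strategy M) s :
  s \notin obj_goal psi ->
  rew_at psi sigma 0 s =
  \sum_s' trans M s (sigma s) s' * obj_rew psi s (sigma s) s'.
Proof.
move=> sG; rewrite rew_at0// (sum_act_state (b := sigma s)) /=.
  by apply: eq_bigr => s' _; rewrite /ps_choose eqxx mul1r.
by move=> t /negPf ts; rewrite /ps_choose /= ts !mul0r.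
Qed.

Lemma rew_at_psS (R : realType) (S Act : finType) (M : mdp R S Act)
    (psi : objective R S Act) (sigma : ps_strategy M) i s :
  s \notin obj_goal psi ->
  rew_at psi sigma i.+1 s =
  \sum_s' trans M s (sigma s) s' * rew_at psi sigma i s'.
Proof.
move=> sG; rewrite (@rew_atS _ _ _ _ _ sigma sigma)//; last first.
  by move=> t h; exact: cont_prob_ps.
rewrite (sum_act_state (b := sigma s)) /=.
  by apply: eq_bigr => s' _; rewrite /ps_choose eqxx mul1r.
by move=> t /negPf ts; rewrite /ps_choose /= ts !mul0r.
Qed.

Lemma exp_reward_ps (R : realType) (S Act : finType) (M : mdp R S Act)
    (psi : objective R S Act) (sigma : ps_strategy M) (V : S -> R) s :
  (forall s, exp_reward s sigma psi = (V s)%:E) ->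
  s \notin obj_goal psi ->
  V s = \sum_s' trans M s (sigma s) s' * (obj_rew psi s (sigma s) s' + V s').
Proof.
move=> VE sG; apply: EFin_inj; rewrite -VE.
rewrite (@exp_reward_first_step _ _ _ _ _ sigma sigma)//; last first.
  by move=> t h; exact: cont_prob_ps.
rewrite -sumEFin (sum_act_state (b := sigma s)) /=.
  by apply: eq_bigr => s' _; rewrite VE /ps_choose eqxx mul1r.
by move=> t /negPf ts; rewrite /ps_choose /= ts !mul0r mul0e.
Qed.

(** By induction on [n], the sum of the first [n] terms of the series is at most [w]: the first-step
    recursion turns [n.+1] terms into one reward plus [n] terms at the successors. The alternative
    of value 0 admits states, such as those of [S_zero], whose successors may lie outside [B]. *)
Lemma exp_reward_ps_le (R : realType) (S Act : finType) (M : mdp R S Act)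
    (psi : objective R S Act) (sigma : ps_strategy M) (B : {set S}) (w : S -> R) :
  (forall s, s \in B -> 0 <= w s) ->
  (forall s, s \in B -> exp_reward s sigma psi = 0%E \/
     \sum_s' trans M s (sigma s) s' * (obj_rew psi s (sigma s) s' + w s') <= w s /\
     succs M s (sigma s) \subset B) ->
  forall s, s \in B -> (exp_reward s sigma psi <= (w s)%:E)%E.
Proof.
move=> w0 wB.
have r0 s i : (0 <= (rew_at psi sigma i s)%:E)%E by rewrite lee_fin rew_at_ge0.
have bound n s : s \in B -> \sum_(i < n) rew_at psi sigma i s <= w s.
  elim: n s => [|n IH] s sB; first by rewrite big_ord0 w0.
  have zero : exp_reward s sigma psi = 0%E ->
      \sum_(i < n.+1) rew_at psi sigma i s <= w s.
    move=> E0; apply: le_trans (w0 _ sB).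
    rewrite -lee_fin -sumEFin -[X in (_ <= X)%E]E0 exp_reward_series.
    rewrite -(big_mkord xpredT (fun i => (rew_at psi sigma i s)%:E)).
    by apply: nneseries_lim_ge => i _ _.
  have [/zero//|[ws /fintype.subsetP sub]] := wB s sB.
  have [/(exp_reward_goal sigma)/zero//|sG] := boolP (s \in obj_goal psi).
  apply: le_trans ws; rewrite big_ord_recl rew_at_ps0//.
  under [X in _ + X]eq_bigr do rewrite lift0 rew_at_psS//.
  rewrite exchange_big/= -big_split/=; apply: ler_sum => s' _.
  rewrite -mulr_sumr -mulrDr.
  have [s'B|s'B] := boolP (s' \in succs M s (sigma s)); last first.
    by rewrite trans_eq0// !mul0r.
  by rewrite ler_wpM2l ?trans_ge0// lerD2l IH// sub.
move=> s sB; rewrite exp_reward_series; apply: lime_le.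
  by apply: is_cvg_nneseries => i _ _.
by apply: nearW => n; rewrite sumEFin lee_fin big_mkord bound.
Qed.

(** * One-step deviations from a pure stationary strategy *)

(** Testing for the empty history confines the deviation to the first step: a later return to [s0]
    follows [sigma], so the value after one step is that of [sigma]. *)
Definition deviate_choose (R : realType) (S Act : finType) (M : mdp R S Act)
    (sigma : ps_strategy M) (s0 : S) (b : Act) (s : S) (h : seq (Act * S))
    (a : Act) : R :=
  if nilp h && (s == s0) then (a == b)%:R else ps_choose sigma s h a.

Lemma deviate_choose_ge0 (R : realType) (S Act : finType) (M : mdp R S Act)
    (sigma : ps_strategy M) s0 b s h a : 0 <= deviate_choose sigma s0 b s h a.
Proof. by rewrite /deviate_choose; case: ifP => _; exact: ler0n. Qed.

Lemma deviate_choose_sum (R : realType) (S Act : finType) (M : mdp R S Act)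
    (sigma : ps_strategy M) s0 b s h :
  \sum_a deviate_choose sigma s0 b s h a = 1.
Proof.
rewrite /deviate_choose; case: (_ && _); last exact: ps_choose_sum.
by rewrite (bigD1 b)//= eqxx big1 ?addr0// => a /negPf ->.
Qed.

Lemma deviate_choose_enabled (R : realType) (S Act : finType) (M : mdp R S Act)
    (sigma : ps_strategy M) s0 b (hb : b \in enabled M s0) s h a :
  0 < deviate_choose sigma s0 b s h a -> a \in enabled M (hist_last s h).
Proof.
rewrite /deviate_choose; case: ifP => [/andP[/nilP-> /eqP->]|_]; last first.
  exact: ps_choose_enabled.
by case: eqP => [-> _ //|_]; rewrite ltxx.
Qed.

Definition deviate (R : realType) (S Act : finType) (M : mdp R S Act)
    (sigma : ps_strategy M) s0 b (hb : b \in enabled M s0) : strategy M :=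
  Strategy (deviate_choose_ge0 sigma s0 b) (deviate_choose_sum sigma s0 b)
    (deviate_choose_enabled (sigma := sigma) hb).

Lemma cont_prob_deviate (R : realType) (S Act : finType) (M : mdp R S Act)
    (sigma : ps_strategy M) s0 b (hb : b \in enabled M s0) s t g h :
  cont_prob (deviate sigma hb) s (t :: g) h = cont_prob sigma s (t :: g) h.
Proof. by elim: h g => // -[a s'] h IH g /=; rewrite IH. Qed.

Lemma exp_reward_deviate (R : realType) (S Act : finType) (M : mdp R S Act)
    (psi : objective R S Act) (sigma : ps_strategy M) (V : S -> R) s b
    (hb : b \in enabled M s) :
  (forall s, exp_reward s sigma psi = (V s)%:E) ->
  s \notin obj_goal psi ->
  exp_reward s (deviate sigma hb) psi =
  (\sum_s' trans M s b s' * (obj_rew psi s b s' + V s'))%:E.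
Proof.
move=> VE sG; rewrite (@exp_reward_first_step _ _ _ _ _ _ sigma)//; last first.
  by move=> t h; rewrite cont_prob_deviate; exact: cont_prob_ps.
rewrite -sumEFin (sum_act_state (b := b)) /=.
  by apply: eq_bigr => s' _; rewrite VE /deviate_choose /= !eqxx mul1r.
by move=> t /negPf ts; rewrite /deviate_choose /= eqxx ts !mul0r mul0e.
Qed.

(** * The minimum principle and almost sure reachability *)

(** The terms [K i * (V i - m)] are nonnegative and their sum is at most 0, so each vanishes. Along
    transitions this propagates a least value to all successors. *)
Lemma convex_comb_min (R : realType) (S : finType) (K V : S -> R) (m : R) :
  (forall s, 0 <= K s) -> \sum_s K s = 1 ->
  (forall s, 0 < K s -> m <= V s) -> \sum_s K s * V s <= m ->
  forall s, 0 < K s -> V s = m.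
Proof.
move=> K0 K1 mV KV s Ks.
have ge0 i : true -> 0 <= K i * (V i - m).
  move=> _; have := K0 i; rewrite le_eqVlt => /predU1P[<-|Ki].
    by rewrite mul0r.
  by rewrite mulr_ge0// subr_ge0 mV.
have /(psumr_eq0P ge0)/(_ s isT)/eqP : \sum_i K i * (V i - m) = 0.
  apply/eqP; rewrite eq_le sumr_ge0// andbT.
  under eq_bigr do rewrite mulrBr.
  by rewrite big_split/= sumrN -mulr_suml K1 mul1r subr_le0.
by rewrite mulf_eq0 gt_eqF//= subr_eq0 => /eqP.
Qed.

Lemma connect_preserves (T : finType) (e : rel T) (P : T -> Prop) :
  (forall x y, e x y -> P x -> P y) -> forall x y, connect e x y -> P x -> P y.
Proof.
move=> eP x y /connectP[q qp ->]; elim: q x qp => //= z q IH x /andP[xz qz] Px.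
by apply: IH => //; exact: eP Px.
Qed.

Definition ps_step (R : realType) (S Act : finType) (M : mdp R S Act)
    (sigma : ps_strategy M) : rel S :=
  [rel s t | t \in succs M s (sigma s)].

(** Makes a reachability probability an expected reward: the total is 1 if [t] is reached from
    another starting state, and 0 otherwise. *)
Definition reach_obj (R : realType) (S Act : finType) (t : S)
    : objective R S Act :=
  @Objective R S Act CmpGe (fun _ _ s' => (s' == t)%:R)
    (fun _ _ _ => ler0n _ _) [set t]%SET.

Lemma reward_until_reach (R : realType) (S Act : finType) (M : mdp R S Act)
    (t : S) (p : path_space M) :
  reward_until (M := M) (obj_rew (reach_obj R Act t))
    (obj_goal (reach_obj R Act t)) p =
  (\1_[set p : path_space M | p.1 != t /\
      exists n, pstate (M := M) p n = t] p)%:E.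
Proof.
rewrite indicE /reward_until /sum_until; case: pselect => hit; last first.
  rewrite memNset ?eseries0//; last first.
    by move=> -[_ [n pn]]; apply: hit; exists n; rewrite pn inE.
  move=> i _ _ /=; case: eqP => // pn; exfalso; apply: hit.
  by exists i.+1; rewrite inE /= pn.
case: ex_minnP => -[|n] nG nmin.
  rewrite big_geq// memNset//= => -[/negP p1 _]; apply: p1.
  by move: nG; rewrite inE.
rewrite mem_set; last first.
  split; last by exists n.+1; move: nG; rewrite inE => /eqP.
  apply/negP => p1; have := nmin 0%N; rewrite inE => /(_ p1).
  by rewrite ltn0.
rewrite big_nat_recr//= big_nat big1 ?add0e; last first.
  move=> i /andP[_ ilt]; case: eqP => // pi; have := nmin i.+1.
  by rewrite inE /= pi eqxx => /(_ isT); rewrite ltnS leqNgt ilt.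
by move: nG; rewrite inE /= => ->.
Qed.

Lemma hist_last_mkseq (R : realType) (S Act : finType) (M : mdp R S Act)
    (p : ipath M) n : hist_last p.1 (mkseq p.2 n) = pstate p n.
Proof. by case: n => // n; rewrite /hist_last mkseqS map_rcons last_rcons. Qed.

Lemma measurable_reach (R : realType) (S Act : finType) (M : mdp R S Act)
    (t : S) :
  measurable [set p : path_space M | exists n, pstate (M := M) p n = t].
Proof.
have -> : [set p : path_space M | exists n, pstate (M := M) p n = t] =
    \bigcup_n [set p : path_space M | pstate (M := M) p n = t].
  by apply/seteqP; split => [p [n pn]|p [n _ pn]]; [exists n|exists n].
apply: bigcup_measurable => n _.
pose F s (h : seq (Act * S)) : R := (hist_last s h == t)%:R.
have -> : [set p : path_space M | pstate (M := M) p n = t] =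
    (fun p : path_space M => (F p.1 (mkseq p.2 n))%:E) @^-1` [set 1%E].
  apply/seteqP; split => p; rewrite /preimage /= /F (@hist_last_mkseq _ _ _ M).
    by move=> ->; rewrite eqxx.
  by case: eqP => // _ [] /eqP; rewrite eq_sym oner_eq0.
rewrite -[X in measurable X]setTI.
exact: (measurable_word_fun n F measurableT (emeasurable_set1 _)).
Qed.

(** The reachability probability is its own average over successors at every state other than [t]. A
    minimum below 1 would propagate along the transitions of [sigma] as far as [t], where the
    probability is 1. *)
Lemma reach_prob1 (R : realType) (S Act : finType) (M : mdp R S Act)
    (sigma : ps_strategy M) (t : S) :
  (forall s, connect (ps_step sigma) s t) ->
  forall s, s != t ->
  path_prob s sigma
    [set p : path_space M | exists n, pstate (M := M) p n = t] = 1%E.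
Proof.
move=> conn; pose psi := reach_obj R Act t.
pose A := [set p : path_space M | exists n, pstate (M := M) p n = t].
have mA : measurable A := @measurable_reach _ _ _ M t.
pose B := [set p : path_space M | p.1 != t /\ A p].
have mB : measurable B.
  have -> : B = A `&` ~` (cyl t [::] : set (path_space M)).
    apply/seteqP; split => p.
      by move=> [/eqP p1 pA]; split => // -[/p1].
    by move=> [pA np]; split => //; apply/eqP => p1; apply: np; split.
  by apply: measurableI => //; apply: measurableC; exact: measurable_cyl.
have EB s : exp_reward s sigma psi = path_prob s sigma B.
  rewrite /exp_reward; under eq_integral do rewrite reward_until_reach.
  by rewrite integral_indic// setIT.
have EA s : (exp_reward s sigma psi <= path_prob s sigma A)%E.
  by rewrite EB; apply: le_measure; rewrite ?inE// => p [].
have A1 s : (path_prob s sigma A <= 1)%E := probability_le1 _ mA.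
pose V s := fine (exp_reward s sigma psi).
have VE s : exp_reward s sigma psi = (V s)%:E.
  rewrite fineK// ge0_fin_numE ?exp_reward_ge0//.
  by rewrite (le_lt_trans (EA s))// (le_lt_trans (A1 s))// ltry.
have V1 s : V s <= 1 by rewrite -lee_fin -VE (le_trans (EA s)).
(* A path starting in [t] earns nothing, so [V t] is 0 and has to be replaced by 1. *)
pose g s := if s == t then 1 else V s.
have g1 s : g s <= 1 by rewrite /g; case: ifP.
have gstep s : s != t -> \sum_s' trans M s (sigma s) s' * g s' = g s.
  move=> st; rewrite /g (negPf st) (exp_reward_ps VE) ?inE//.
  apply: eq_bigr => s' _; congr (_ * _); rewrite /=; case: eqVneq => [->|].
    by apply: EFin_inj; rewrite EFinD -VE exp_reward_goal ?adde0// inE.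
  by rewrite add0r.
suff gE s : g s = 1.
  move=> s st; apply/eqP; rewrite eq_le A1 (le_trans _ (EA s))// VE.
  by have := gE s; rewrite /g (negPf st) => ->.
case: (@Order.TotalTheory.arg_minP _ _ _ s xpredT g isT) => s1 _ smin.
have [|m1] := leP 1 (g s1).
  by move=> h; apply/eqP; rewrite eq_le g1 (le_trans h)// smin.
suff : g t = g s1 by rewrite {1}/g eqxx => e; rewrite -e ltxx in m1.
apply: (@connect_preserves _ (ps_step sigma) (fun x => g x = g s1)) (conn s1) _ => //.
move=> x y xy gx; move: xy; rewrite /ps_step /= inE => xy.
apply: (@convex_comb_min _ _ (trans M x (sigma x)) g (g s1)) => //.
- by move=> ?; exact: trans_ge0.
- by apply: trans_sum1; exact: ps_act_enabled.
- by move=> ? _; exact: smin.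
- rewrite -gx gstep//; apply/eqP => xt.
  by move: gx m1; rewrite /g xt eqxx => <-; rewrite ltxx.
Qed.

(** * Expected numbers of visits *)

(** The reward looks at the source of a transition, so a visit at time 0 counts and the state in
    which [G] is entered does not. *)
Definition visit_obj (R : realType) (S Act : finType) (G : {set S}) (t : S)
    : objective R S Act :=
  @Objective R S Act CmpGe (fun u _ _ => (u == t)%:R)
    (fun _ _ _ => ler0n _ _) G.

Lemma visit_at0 (R : realType) (S Act : finType) (M : mdp R S Act)
    (sigma : ps_strategy M) (G : {set S}) t s :
  s \notin G -> rew_at (visit_obj R Act G t) sigma 0 s = (s == t)%:R.
Proof.
move=> sG; rewrite rew_at_ps0// -mulr_suml trans_sum1 ?mul1r//.
exact: ps_act_enabled.
Qed.

(** A recursion on the last step rather than the first: being in [t] at time [i.+1] means moving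
    there from some [u] occupied at time [i]. It follows from the first-step recursion by induction
    on [i] and an exchange of sums. *)
Lemma visit_atS (R : realType) (S Act : finType) (M : mdp R S Act)
    (sigma : ps_strategy M) (G : {set S}) t i s :
  t \notin G ->
  rew_at (visit_obj R Act G t) sigma i.+1 s =
  \sum_u trans M u (sigma u) t * rew_at (visit_obj R Act G u) sigma i s.
Proof.
move=> tG; elim: i s => [|i IH] s.
all: have [sG|sG] := boolP (s \in G).
- by rewrite rew_at_goal// big1// => u _; rewrite rew_at_goal// mulr0.
- rewrite rew_at_psS// (bigD1 t)//= visit_at0// eqxx mulr1 big1 ?addr0; last first.
    move=> u ut; have [uG|uG] := boolP (u \in G).
      by rewrite rew_at_goal// mulr0.
    by rewrite visit_at0// (negPf ut) mulr0.
  rewrite (bigD1 s)//= visit_at0// eqxx mulr1 big1 ?addr0// => u us.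
  by rewrite visit_at0// eq_sym (negPf us) mulr0.
- by rewrite rew_at_goal// big1// => u _; rewrite rew_at_goal// mulr0.
- rewrite rew_at_psS//; under eq_bigr do rewrite IH mulr_sumr.
  rewrite exchange_big/=; apply: eq_bigr => u _; rewrite rew_at_psS//.
  by rewrite mulr_sumr; apply: eq_bigr => s' _; rewrite mulrCA.
Qed.

(** Sum the last-step recursion over all times; the term of time 0 is the initial visit. *)
Lemma exp_visits_flow (R : realType) (S Act : finType) (M : mdp R S Act)
    (sigma : ps_strategy M) (G : {set S}) s t :
  s \notin G -> t \notin G ->
  exp_reward s sigma (visit_obj R Act G t) =
  ((s == t)%:R%:E + \sum_u (trans M u (sigma u) t)%:E *
     exp_reward s sigma (visit_obj R Act G u))%E.
Proof.
move=> sG tG; have r0 psi i : (0 <= (rew_at psi sigma i s)%:E)%E.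
  by rewrite lee_fin rew_at_ge0.
rewrite exp_reward_series nneseries_recl// -nneseries_addn// visit_at0//.
congr (_ + _)%E; under eq_eseriesr do rewrite addn1 visit_atS// -sumEFin.
rewrite nneseries_sum; last first.
  by move=> u i _; rewrite lee_fin mulr_ge0 ?trans_ge0 ?rew_at_ge0.
apply: eq_bigr => u _; rewrite exp_reward_series -nneseriesZl//.
Qed.

(** * The states of [S_maybe] and end components induced by a strategy *)

Lemma mem_states_of (S Act : finType) (E : {set S * Act}) s b :
  (s, b) \in E -> s \in states_of E.
Proof. by move=> sb; rewrite inE; apply/existsP; exists b. Qed.

Lemma goal_sub_S_zero (R : realType) (S Act : finType) (M : mdp R S Act)
    (psi : objective R S Act) s : s \in obj_goal psi -> s \in S_zero M psi.
Proof.
by move=> sG; rewrite inE; apply/asboolP => sigma; exact: exp_reward_goal.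
Qed.

Lemma S_maybe_notin_goal (R : realType) (S Act : finType) (M : mdp R S Act)
    (psi : objective R S Act) s : s \in S_maybe M psi -> s \notin obj_goal psi.
Proof.
by rewrite inE => /andP[+ _]; apply: contra; exact: goal_sub_S_zero.
Qed.

Lemma S_maybe_succs (R : realType) (S Act : finType) (M : mdp R S Act)
    (psi : objective R S Act) s b s' :
  s \in S_maybe M psi -> s' \in succs M s b ->
  s' \in S_zero M psi :|: S_maybe M psi.
Proof.
rewrite [s \in _]inE => /andP[s0 cs] ss'; rewrite inE.
have [//|s'0 /=] := boolP (s' \in S_zero M psi).
rewrite inE s'0 /=; apply: connect_trans cs (connect1 _).
by rewrite /step_avoiding /= s0 s'0; apply/existsP; exists b.
Qed.

Lemma init_S_zero_maybe (R : realType) (S Act : finType) (M : mdp R S Act)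
    (psi : objective R S Act) : init M \in S_zero M psi :|: S_maybe M psi.
Proof.
rewrite inE; have [//|i0 /=] := boolP (init M \in S_zero M psi).
by rewrite inE i0 connect0.
Qed.

Lemma S_zero_exp_reward (R : realType) (S Act : finType) (M : mdp R S Act)
    (psi : objective R S Act) s :
  s \in S_zero M psi -> forall sigma : strategy M, exp_reward s sigma psi = 0%E.
Proof. by rewrite inE => /asboolP. Qed.

(* A state of [D] with a reachable set of least size reaches exactly a bottom
   strongly connected component. *)
Lemma ps_closed_mec (R : realType) (S Act : finType) (M : mdp R S Act)
    (psi : objective R S Act) (sigma : ps_strategy M) (D : {set S}) :
  D != finset.set0 -> D \subset S_maybe M psi ->
  (forall s, s \in D -> succs M s (sigma s) \subset D) ->
  exists E, exists C : {set S},
    [/\ is_mec M psi E, C != finset.set0, C \subset D,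
        forall s, s \in C -> succs M s (sigma s) \subset C &
        forall s, s \in C -> (s, sigma s) \in E].
Proof.
move=> /set0Pn[s0 s0D] /fintype.subsetP DS Dcl.
pose reach s := [set t | connect (ps_step sigma) s t]%SET.
case: (@arg_minnP _ s0 [pred s | s \in D] (fun s => #|reach s|) s0D) => s1 s1D smin.
pose C := reach s1.
have CD : C \subset D.
  apply/fintype.subsetP => t; rewrite inE => st.
  apply: (@connect_preserves _ (ps_step sigma) (fun x => x \in D)) st s1D.
  by move=> x y xy xD; exact: (fintype.subsetP (Dcl _ xD)).
have Ccl s : s \in C -> succs M s (sigma s) \subset C.
  rewrite inE => s1s; apply/fintype.subsetP => t st; rewrite inE.
  exact: connect_trans s1s (connect1 _).
have reachC s : s \in C -> reach s = C.
  move=> sC; apply/eqP; rewrite eqEcard smin ?andbT; last first.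
    exact: (fintype.subsetP CD).
  apply/fintype.subsetP => t; rewrite !inE in sC *; exact: connect_trans.
(* The pairs chosen by [sigma] on [C] form an end component inside [E_maybe], and some maximal one
   contains it. *)
pose F := [set (s, sigma s) | s in C]%SET.
have FP u b : ((u, b) \in F) = (u \in C) && (b == sigma u).
  by apply/imsetP/andP => [[t tC [-> ->]]//|[uC /eqP ->]]; exists u.
have sF : states_of F = C.
  apply/setP => s; rewrite inE; apply/existsP/idP.
    by move=> [b]; rewrite FP => /andP[].
  by move=> sC; exists (sigma s); rewrite FP sC eqxx.
have s1C : s1 \in C by rewrite inE connect0.
have Fcl : closed_sub M F.
  apply/forall_inP => -[s b]; rewrite FP => /andP[sC /eqP ->] /=.
  by rewrite ps_act_enabled sF Ccl.
have Fec : is_ec M F.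
  apply/and3P; split => //.
    by apply/set0Pn; exists (s1, sigma s1); rewrite FP s1C eqxx.
  rewrite sF; apply/forall_inP => u uC; apply/forall_inP => v vC.
  have uv : connect (ps_step sigma) u v.
    by move: vC; rewrite -(reachC u uC) inE.
  suff [] : v \in C /\ connect (step_in M F) u v by [].
  apply: (@connect_preserves _ (ps_step sigma)
    (fun x => x \in C /\ connect (step_in M F) u x)) uv _ => //.
  move=> x y xy [xC ux]; split; first exact: (fintype.subsetP (Ccl _ xC)).
  apply: connect_trans ux (connect1 _); apply/existsP; exists (sigma x).
  by rewrite FP xC eqxx.
have FE : F \subset E_maybe M psi.
  apply: (finset.bigcup_sup F) => //; rewrite Fcl /=.
  apply/fintype.subsetP => -[s b]; rewrite FP => /andP[sC _].
  by rewrite finset.in_setX finset.in_setT andbT; apply: DS; exact: (fintype.subsetP CD).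
have [E Emax FsE] := @maxset_exists _
  (fun F => is_ec M F && (F \subset E_maybe M psi)) F (introT andP (conj Fec FE)).
exists E, C; split => //; first by apply/set0Pn; exists s1.
by move=> s sC; apply: (fintype.subsetP FsE); rewrite FP sC eqxx.
Qed.

Lemma mec_ec (R : realType) (S Act : finType) (M : mdp R S Act)
    (psi : objective R S Act) E : is_mec M psi E -> is_ec M E.
Proof. by move=> /maxsetP[/andP[]]. Qed.

Lemma ec_closed (R : realType) (S Act : finType) (M : mdp R S Act)
    (E : {set S * Act}) s b :
  is_ec M E -> (s, b) \in E ->
  b \in enabled M s /\ succs M s b \subset states_of E.
Proof. by move=> /and3P[_ /forall_inP cE _] /cE /andP[]. Qed.

(** * From a solution of the constraints to a strategy *)

Lemma sum_pres (R : realType) (S Act : finType) (M : mdp R S Act)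
    (E : {set S * Act}) s (z : S -> Act -> R) :
  \sum_(sb in pres M s :&: E) trans M sb.1 sb.2 s * z sb.1 sb.2 =
  \sum_(sb in E) trans M sb.1 sb.2 s * z sb.1 sb.2.
Proof.
rewrite [RHS](bigID (mem (pres M s)))/= [X in _ = _ + X]big1 ?addr0.
  by apply: eq_bigl => sb; rewrite inE andbC.
by move=> sb /andP[_ nsb]; rewrite trans_eq0 ?mul0r//; rewrite !inE in nsb *.
Qed.

(* Nothing flows out of [C] except through the stopping action, while at
   least [#|C| / #|states_of E|] flows in. *)
Lemma C3_flow_stops (R : realType) (S Act : finType) (M : mdp R S Act)
    (l : nat) (Q : query R S Act l) (U : 'I_l -> S -> rat)
    (X : {set S * Act} -> S -> rat) a x e ea z zb
    (c3 : C3 M Q U X a x e ea z zb) (sigma : ps_strategy M) j E (C : {set S}) :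
  (forall s b, b \in enabled M s -> b != sigma s -> a s b = 0) ->
  is_mec M (Q j) E -> C != finset.set0 ->
  (forall s, s \in C -> succs M s (sigma s) \subset C) ->
  (forall s, s \in C -> (s, sigma s) \in E) ->
  exists2 s, s \in C & e j s = 1.
Proof.
move=> a0 mE C0 Ccl CE; have ecE := mec_ec mE.
have CS s : s \in C -> s \in states_of E by move=> /CE/mem_states_of.
apply: contrapT => noe.
have e0 s : s \in C -> e j s = 0.
  move=> sC; have [//|e1] := C3_e_bin c3 mE (CS s sC).
  by exfalso; apply: noe; exists s.
have zge s b : (s, b) \in E -> 0 <= z j s b.
  move=> sb; have [ben _] := ec_closed ecE sb.
  by have /andP[] := C3_z_bounds c3 mE (mem_states_of sb) ben.
(* On [C] the stopping flow vanishes because [e] is 0, and the flow of actions not chosen because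
   [a] is 0; the whole outflow uses [sigma s]. *)
have flow s : s \in C -> z j s (sigma s) =
    #|states_of E|%:R^-1 + \sum_(sb in E) trans M sb.1 sb.2 s * z j sb.1 sb.2.
  move=> sC; rewrite -sum_pres -(C3_flow c3 mE (CS s sC)).
  have -> : zb j s = 0.
    have := C3_zb_bounds c3 mE (CS s sC); rewrite e0// mulr0 => h.
    by apply/eqP; rewrite eq_le andbC.
  rewrite add0r (bigD1 (sigma s)) ?ps_act_enabled//= big1 ?addr0// => b.
  move=> /andP[ben bs]; have := C3_z_bounds c3 mE (CS s sC) ben.
  by rewrite a0// mulr0 => h; apply/eqP; rewrite eq_le andbC.
have inflow s : \sum_(s' in C) trans M s' (sigma s') s * z j s' (sigma s') <=
    \sum_(sb in E) trans M sb.1 sb.2 s * z j sb.1 sb.2.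
  rewrite -(big_imset (h := fun s => (s, sigma s))
    (fun sb => trans M sb.1 sb.2 s * z j sb.1 sb.2))/=; last by move=> ? ? _ _ [].
  rewrite [X in _ <= X](bigID (mem [set (s, sigma s) | s in C]%SET))/=.
  rewrite -[X in X <= _]addr0; apply: lerD; last first.
    by apply: sumr_ge0 => -[s' b'] /andP[/zge h _]; rewrite mulr_ge0 ?trans_ge0.
  rewrite le_eqVlt; apply/orP; left; apply/eqP/eq_bigl => sb; rewrite andbC.
  by case: (boolP (sb \in _)) => //= /imsetP[t tC ->]; rewrite CE.
have : \sum_(s in C) z j s (sigma s) >=
    \sum_(s in C) (#|states_of E|%:R^-1 +
      \sum_(s' in C) trans M s' (sigma s') s * z j s' (sigma s')).
  by apply: ler_sum => s sC; rewrite flow// lerD2l.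
(* From each state of [C] the probabilities of staying in [C] sum to 1, so the flow over [C] occurs
   on both sides. Cancelling it leaves a positive source term that would be at most 0. *)
rewrite big_split/= exchange_big/=.
rewrite [X in _ + X](eq_bigr (fun s => z j s (sigma s))); last first.
  move=> s sC; rewrite -mulr_suml (_ : \sum_(i in C) _ = 1) ?mul1r//.
  rewrite -(trans_sum1 (ps_act_enabled sigma s)) [RHS](bigID (mem C))/=.
  rewrite [X in _ = _ + X]big1 ?addr0// => s' s'C; apply: trans_eq0.
  by apply: contra s'C; exact: (fintype.subsetP (Ccl s sC)).
rewrite gerDr leNgt => /negP; apply; rewrite sumr_const pmulrn_lgt0 ?card_gt0//.
rewrite invr_gt0 ltr0n card_gt0; have /set0Pn[s sC] := C0.
by apply/set0Pn; exists s; exact: CS.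
Qed.

Lemma binary_sum1 (R : realType) (T : finType) (A : {set T}) (f : T -> R) :
  (forall b, b \in A -> f b = 0 \/ f b = 1) -> \sum_(b in A) f b = 1 ->
  exists b, [/\ b \in A, f b = 1 & forall c, c \in A -> c != b -> f c = 0].
Proof.
move=> f01 f1; have f0 b : b \in A -> 0 <= f b.
  by move=> /f01[->|->]; rewrite ?ler01.
have [b bA fb] : exists2 b, b \in A & f b = 1.
  apply: contrapT => nf; move: f1; rewrite big1 => [/eqP|b bA].
    by rewrite eq_sym oner_eq0.
  by have [//|fb] := f01 b bA; exfalso; apply: nf; exists b.
exists b; split => // c cA cb; move: f1; rewrite (bigD1 b)//= fb.
move=> /eqP; rewrite -[X in _ == X]addr0 (inj_eq (addrI _)) => /eqP.
move/psumr_eq0P; apply; last by rewrite cA.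
by move=> i /andP[iA _]; exact: f0.
Qed.

Lemma C1_strategy (R : realType) (S Act : finType) (M : mdp R S Act) (l : nat)
    (Q : query R S Act l) (p : 'rV[R]_l) (U : 'I_l -> S -> rat) a x xa :
  C1 M Q p U a x xa ->
  exists sigma : ps_strategy M,
    forall s b, b \in enabled M s -> a s b = (b == sigma s)%:R.
Proof.
move=> c1.
have /choice[f fP] s := binary_sum1 (C1_a_bin c1 (s := s)) (C1_a_sum c1 s).
have fen s : f s \in enabled M s by have [] := fP s.
exists (PSStrategy fen) => s b ben /=; have [_ f1 f0] := fP s.
by case: eqVneq => [->//|]; exact: f0.
Qed.

(** Splits the slack of the constraint on [x j s] for [<=] into one unit per action not chosen. *)
Lemma card_sub1_sum (R : realType) (T : finType) (A : {set T}) b :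
  b \in A -> #|A|%:R - 1 = \sum_(c in A | c != b) 1 :> R.
Proof.
by move=> bA; rewrite -sum1_card natr_sum (bigD1 b)//= addrAC subrr add0r.
Qed.

Lemma C1_exp_reward_le (R : realType) (S Act : finType) (M : mdp R S Act)
    (l : nat) (Q : query R S Act l) (p : 'rV[R]_l) (U : 'I_l -> S -> rat) a x xa
    (c1 : C1 M Q p U a x xa) (sigma : ps_strategy M) j :
  (forall s b, b \in enabled M s -> a s b = (b == sigma s)%:R) ->
  obj_cmp (Q j) = CmpLe ->
  (exp_reward (init M) sigma (Q j) <= (- x j (init M))%:E)%E.
Proof.
move=> aE cj.
apply: (@exp_reward_ps_le _ _ _ _ (Q j) sigma
  (S_zero M (Q j) :|: S_maybe M (Q j)) (fun s => - x j s)) (init_S_zero_maybe _ _).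
  move=> s; rewrite inE => /orP[s0|s1]; first by rewrite (C1_x_zero c1 s0) oppr0.
  by have := C1_x_bounds c1 s1; rewrite cj /= mulN1r => /andP[].
move=> s; rewrite inE => /orP[s0|s1]; first by left; exact: S_zero_exp_reward.
right; split; last first.
  by apply/fintype.subsetP => s'; exact: S_maybe_succs.
have sen := ps_act_enabled sigma s.
have := C1_xa_step c1 s1 sen; rewrite cj /=.
rewrite (_ : \sum_s' _ = - \sum_s' trans M s (sigma s) s' *
    (obj_rew (Q j) s (sigma s) s' + - x j s')); last first.
  by rewrite -sumrN; apply: eq_bigr => s' _; rewrite -mulrN opprD opprK addrC mulN1r.
rewrite lerNr => /le_trans; apply; rewrite lerN2.
apply: le_trans (C1_x_choice c1 s1) _; rewrite cj /= mul1r.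
(* Each action not chosen has [xa] at most [- U], which uses up its unit of slack; hence [x j s] is
   at most [xa j s (sigma s)]. *)
rewrite (bigD1 (sigma s))//= -addrA gerDl.
rewrite (card_sub1_sum _ sen) mulr_suml -big_split/=; apply: sumr_le0 => b /andP[ben bs].
have := C1_xa_choice c1 s1 ben; rewrite cj aE// (negPf bs) /= sub0r mulrN1 mul1r.
by rewrite -lerBrDr sub0r.
Qed.

Lemma C1_C3_exp_reward_ge (R : realType) (S Act : finType) (M : mdp R S Act)
    (l : nat) (Q : query R S Act l) (p : 'rV[R]_l)
    (U : 'I_l -> S -> rat) (X : {set S * Act} -> S -> rat)
    a x xa e ea z zb (c1 : C1 M Q p U a x xa) (c3 : C3 M Q U X a x e ea z zb)
    (sigma : ps_strategy M) j :
  (forall s b, b \in enabled M s -> a s b = (b == sigma s)%:R) ->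
  (forall s, (exp_reward s sigma (Q j) < +oo)%E) ->
  obj_cmp (Q j) = CmpGe ->
  ((x j (init M))%:E <= exp_reward (init M) sigma (Q j))%E.
Proof.
move=> aE hfin cj; pose psi := Q j.
pose V s := fine (exp_reward s sigma psi).
have VE s : exp_reward s sigma psi = (V s)%:E.
  by rewrite fineK// ge0_fin_numE ?exp_reward_ge0// hfin.
have V0 s : 0 <= V s by rewrite -lee_fin -VE exp_reward_ge0.
have Vz s : s \in S_zero M psi -> V s = 0.
  by move=> s0; apply: EFin_inj; rewrite -VE; exact: S_zero_exp_reward.
(* For [>=], actions not chosen have [xa] at most 0, so [x j s] is at most [xa j s (sigma s)];
   subtracting the first-step equation of [V] removes the rewards. *)
have step s : s \in S_maybe M psi ->
    x j s - V s <= \sum_s' trans M s (sigma s) s' * (x j s' - V s').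
  move=> s1; have sen := ps_act_enabled sigma s.
  rewrite [V s](exp_reward_ps VE) ?(S_maybe_notin_goal s1)// lerBlDr -big_split/=.
  apply: le_trans (C1_x_choice c1 s1) _; rewrite cj /= !mul0r addr0.
  rewrite (bigD1 (sigma s))//= -[X in _ <= X]addr0; apply: lerD.
    apply: le_trans (C1_xa_step c1 s1 sen) _; rewrite cj /=.
    apply: ler_sum => s' _; rewrite -mulrDr mul1r ler_wpM2l ?trans_ge0//.
    by rewrite [obj_rew _ _ _ _ + _]addrC addrA subrK.
  apply: sumr_le0 => b /andP[ben bs].
  by have := C1_xa_choice c1 s1 ben; rewrite cj aE// (negPf bs) /= subr0 mulr0.
rewrite VE lee_fin -subr_le0; have := init_S_zero_maybe M psi.
rewrite inE => /orP[i0|i1]; first by rewrite (C1_x_zero c1 i0) Vz// subr0.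
case: (@Order.TotalTheory.arg_maxP _ _ _ (init M) [pred s | s \in S_maybe M psi]
  (fun s => x j s - V s) i1) => sm sm1 smax.
apply: le_trans (smax _ i1) _; rewrite leNgt; apply/negP => m0.
set m := x j sm - V sm in m0 smax.
pose D := [set s in S_maybe M psi | x j s - V s == m]%SET.
have Dcl s : s \in D -> succs M s (sigma s) \subset D.
  rewrite inE => /andP[s1 /eqP sm']; apply/fintype.subsetP => t st.
  (* The signs turn the maximum into a minimum. Successors in [S_zero] have difference 0, which is
     below [m]. *)
  have tE : - (x j t - V t) = - m.
    apply: (@convex_comb_min _ _ (trans M s (sigma s)) (fun s => - (x j s - V s))).
    - by move=> ?; exact: trans_ge0.
    - by apply: trans_sum1; exact: ps_act_enabled.
    - move=> u su; rewrite lerN2.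
      have : u \in S_zero M psi :|: S_maybe M psi.
        by apply: S_maybe_succs s1 _; rewrite inE; exact: su.
      rewrite inE => /orP[u0|]; last exact: smax.
      by rewrite (C1_x_zero c1 u0) Vz// subr0 ltW.
    - by under eq_bigr do rewrite mulrN; rewrite sumrN lerN2 -sm' step.
    - by move: st; rewrite inE.
  move/oppr_inj: tE => tE; rewrite inE tE eqxx andbT.
  have := S_maybe_succs s1 st; rewrite inE => /orP[t0|//].
  by move: m0; rewrite -tE (C1_x_zero c1 t0) Vz// subr0 ltxx.
have D0 : D != finset.set0.
  by apply/set0Pn; exists sm; rewrite inE eqxx andbT; exact: sm1.
have DS : D \subset S_maybe M psi.
  by apply/fintype.subsetP => s; rewrite inE => /andP[].
have [E [C [mE C0 CD Ccl CE]]] := ps_closed_mec D0 DS Dcl.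
have [|s sC e1] := C3_flow_stops c3 _ mE C0 Ccl CE.
  by move=> s b ben /negPf bs; rewrite aE// bs.
have := C3_x_e c3 mE (mem_states_of (CE s sC)); rewrite cj e1 /= subrr mulr0 mul1r.
have := fintype.subsetP CD s sC; rewrite inE => /andP[_ /eqP sm'].
move=> x0; move: m0; rewrite -sm' subr_gt0 ltNge => /negP; apply.
exact: le_trans x0 (V0 s).
Qed.

(** * Disjointness of maximal end components, and values on closed sets *)

Lemma states_ofU (S Act : finType) (E F : {set S * Act}) :
  states_of (E :|: F) = states_of E :|: states_of F.
Proof.
apply/setP => s; rewrite !inE; apply/existsP/orP.
  by move=> [b]; rewrite inE => /orP[]; [left|right]; apply/existsP; exists b.
by move=> [] /existsP[b sb]; exists b; rewrite inE sb ?orbT.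
Qed.

(** Any two states of the union are connected through the common state [s], each half of the way
    inside one component. *)
Lemma ec_setU (R : realType) (S Act : finType) (M : mdp R S Act)
    (E F : {set S * Act}) s :
  is_ec M E -> is_ec M F -> s \in states_of E -> s \in states_of F ->
  is_ec M (E :|: F).
Proof.
move=> ecE ecF sE sF; have /and3P[/set0Pn[sa saE] _ cE] := ecE.
have /and3P[_ _ cF] := ecF.
have sub (A B : {set S * Act}) u v : A \subset B ->
    connect (step_in M A) u v -> connect (step_in M B) u v.
  move=> /fintype.subsetP AB; apply: connect_sub => {}u {}v /existsP[b /andP[ub bv]].
  by apply: connect1; apply/existsP; exists b; rewrite AB.
have toE u v : u \in states_of E -> v \in states_of E ->
    connect (step_in M (E :|: F)) u v.
  move=> uS vS; apply: (sub _ _ _ _ (finset.subsetUl _ _)).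
  exact: (forall_inP (forall_inP cE u uS)).
have toF u v : u \in states_of F -> v \in states_of F ->
    connect (step_in M (E :|: F)) u v.
  move=> uS vS; apply: (sub _ _ _ _ (finset.subsetUr _ _)).
  exact: (forall_inP (forall_inP cF u uS)).
apply/and3P; split.
- by apply/set0Pn; exists sa; rewrite inE saE.
- apply/forall_inP => -[v b]; rewrite states_ofU inE => /orP[] vb /=.
    have [-> h] := ec_closed ecE vb.
    by apply: fintype.subset_trans h _; exact: finset.subsetUl.
  have [-> h] := ec_closed ecF vb.
  by apply: fintype.subset_trans h _; exact: finset.subsetUr.
- apply/forall_inP => v; rewrite states_ofU inE => vS.
  apply/forall_inP => w; rewrite inE => wS.
  apply: (@connect_trans _ _ s).
    by case/orP: vS => vS; [exact: toE|exact: toF].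
  by case/orP: wS => wS; [exact: toE|exact: toF].
Qed.

(** The union is again an end component within [E_maybe], so it equals both by maximality. Variables
    of C3 indexed by a state alone can therefore depend on its component. *)
Lemma mec_unique (R : realType) (S Act : finType) (M : mdp R S Act)
    (psi : objective R S Act) (E F : {set S * Act}) s :
  is_mec M psi E -> is_mec M psi F -> s \in states_of E -> s \in states_of F ->
  E = F.
Proof.
move=> /maxsetP[/andP[ecE subE] maxE] /maxsetP[/andP[ecF subF] maxF] sE sF.
have P : is_ec M (E :|: F) && (E :|: F \subset E_maybe M psi).
  by rewrite (ec_setU ecE ecF sE sF) finset.subUset subE subF.
by rewrite -(maxE _ P (finset.subsetUl _ _)) (maxF _ P (finset.subsetUr _ _)).
Qed.

Lemma E_maybe_state (R : realType) (S Act : finType) (M : mdp R S Act)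
    (psi : objective R S Act) s b :
  (s, b) \in E_maybe M psi -> s \in S_maybe M psi.
Proof.
move=> /finset.bigcupP[E /andP[_ /fintype.subsetP sub] /sub].
by rewrite finset.in_setX => /andP[].
Qed.

Lemma mec_state (R : realType) (S Act : finType) (M : mdp R S Act)
    (psi : objective R S Act) E s :
  is_mec M psi E -> s \in states_of E -> s \in S_maybe M psi.
Proof.
move=> /maxsetP[/andP[_ /fintype.subsetP sub] _]; rewrite inE.
by move=> /existsP[b /sub]; exact: E_maybe_state.
Qed.

(* At the states of [C] of least value the reward is 0 and the value is
   constant, so the value is 0 there. *)
Lemma closed_value_zero (R : realType) (S Act : finType) (M : mdp R S Act)
    (psi : objective R S Act) (sigma : ps_strategy M) (V : S -> R) (C : {set S}) :
  (forall s, exp_reward s sigma psi = (V s)%:E) ->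
  C != finset.set0 ->
  (forall s, s \in C -> s \notin obj_goal psi) ->
  (forall s, s \in C -> succs M s (sigma s) \subset C) ->
  exists2 s, s \in C & V s = 0.
Proof.
move=> VE /set0Pn[s0 s0C] CG Ccl.
have V0 s : 0 <= V s by rewrite -lee_fin -VE exp_reward_ge0.
case: (@Order.TotalTheory.arg_minP _ _ _ s0 [pred s | s \in C] V s0C) => s1 s1C smin.
exists s1; first exact: s1C.
pose D := [set s in C | V s == V s1]%SET.
have DE s : s \in D ->
    \sum_t trans M s (sigma s) t * obj_rew psi s (sigma s) t <= 0 /\
    succs M s (sigma s) \subset D.
  rewrite inE => /andP[sC /eqP Vs]; have := exp_reward_ps VE (CG _ sC).
  under eq_bigr do rewrite mulrDr.
  rewrite big_split/=; set r := \sum_t _ * obj_rew _ _ _ _ => Veq.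
  have r0 : 0 <= r.
    by apply: sumr_ge0 => t _; rewrite mulr_ge0 ?trans_ge0 ?obj_rew_ge0.
  have sumV t : 0 < trans M s (sigma s) t -> V t = V s1.
    apply: (@convex_comb_min _ _ (trans M s (sigma s))).
    - by move=> ?; exact: trans_ge0.
    - by apply: trans_sum1; exact: ps_act_enabled.
    - move=> u su; apply: smin; apply: (fintype.subsetP (Ccl s sC)).
      by rewrite inE.
    - by rewrite -Vs Veq lerDr.
  split; last first.
    apply/fintype.subsetP => t st; rewrite inE (fintype.subsetP (Ccl s sC))//=.
    by apply/eqP/sumV; rewrite inE in st.
  have : \sum_t trans M s (sigma s) t * V t = V s1.
    rewrite (eq_bigr (fun t => trans M s (sigma s) t * V s1)).
      by rewrite -mulr_suml trans_sum1 ?mul1r//; exact: ps_act_enabled.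
    move=> t _; have [st|] := boolP (t \in succs M s (sigma s)).
      by rewrite sumV//; rewrite inE in st.
    by move=> /trans_eq0 ->; rewrite !mul0r.
  by move=> E; rewrite E Vs in Veq; rewrite -(lerD2r (V s1)) -Veq add0r.
(* [D] is closed and its expected one-step reward is 0, so the constant 0 is a supersolution on
   it. *)
apply/eqP; rewrite eq_le V0 andbT -lee_fin -VE.
apply: (@exp_reward_ps_le _ _ _ _ psi sigma D (fun=> 0)) => //.
- move=> s sD; right; have [rs ss] := DE s sD; split=> //.
  by under eq_bigr do rewrite addr0.
- by rewrite inE eqxx andbT; exact: s1C.
Qed.

(** * The strategy on the stopped end component: reaching the sink, and flow *)

(** An action of [sigma] outside [E] is kept, as it leads to the sink in [ec_mdp]. In the last case
    one boolean names both the fresh state and its only action. *)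
Definition ec_act (R : realType) (S Act : finType) (M : mdp R S Act)
    (sigma : ps_strategy M) (stop : pred S) (E : {set S * Act})
    (x : ec_state E) : ec_action Act :=
  match x with
  | inl s => if stop (val s) then inr false else inl (sigma (val s))
  | inr c => inr c
  end.

Lemma ec_act_enabled (R : realType) (S Act : finType) (M : mdp R S Act)
    (sigma : ps_strategy M) (stop : pred S) (E : {set S * Act})
    (ecE : is_ec M E) (x : ec_state E) :
  ec_act sigma stop x \in enabled (ec_mdp ecE) x.
Proof.
rewrite inE; apply/existsP; case: x => [[s sS]|c] /=.
  case: ifP => _; first by exists (inr false) => /=.
  have [sE|sE] := boolP ((s, sigma s) \in E).
    have := ps_act_enabled sigma s; rewrite inE => /existsP[t st].
    have [_ /fintype.subsetP sub] := ec_closed ecE sE.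
    have tE : t \in states_of E by apply: sub; rewrite inE.
    by exists (inl (exist _ t tE)).
  by exists (inr false); rewrite ps_act_enabled ltr01.
case: c; last by exists (inr false) => /=.
have /and3P[/set0Pn[[s a] sa] _ _] := ecE.
exists (inl (exist _ s (mem_states_of sa))) => /=.
rewrite invr_gt0 ltr0n card_gt0; apply/set0Pn; exists s.
exact: mem_states_of sa.
Qed.

Definition ec_ps (R : realType) (S Act : finType) (M : mdp R S Act)
    (sigma : ps_strategy M) (stop : pred S) (E : {set S * Act})
    (ecE : is_ec M E) : ps_strategy (ec_mdp ecE) :=
  PSStrategy (ec_act_enabled sigma stop ecE).

(** By [reach_prob1] it suffices that every state has a path to the sink. Otherwise the states
    reachable from one without such a path form a closed set on which [sigma] stays in [E] and never
    stops. *)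
Lemma ec_ps_reaches_sink (R : realType) (S Act : finType) (M : mdp R S Act)
    (sigma : ps_strategy M) (stop : pred S) (E : {set S * Act})
    (ecE : is_ec M E) :
  (forall C : {set S}, C != finset.set0 ->
     (forall s, s \in C -> (s, sigma s) \in E) ->
     (forall s, s \in C -> succs M s (sigma s) \subset C) ->
     exists2 s, s \in C & stop s) ->
  ec_reaches_sink (ec_ps sigma stop ecE).
Proof.
move=> hstop; apply: reach_prob1; last exact/eqP.
pose conn := connect (ps_step (ec_ps sigma stop ecE)).
have conn_inl (s : {s | s \in states_of E}) : conn (inl s) (ec_sink E).
  apply: contrapT => /negP ns.
  pose C := [set val t | t in [pred t | conn (inl s) (inl t)]]%SET.
  have CP t : t \in C -> exists2 u : {s | s \in states_of E},
      t = val u & conn (inl s) (inl u).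
    by move=> /imsetP[u us ->]; exists u.
  have Cgo (u : {s | s \in states_of E}) : conn (inl s) (inl u) ->
      ~~ stop (val u) /\ (val u, sigma (val u)) \in E.
    move=> su; have nostep : ~~ ps_step (ec_ps sigma stop ecE) (inl u) (inr false).
      apply: contra ns => st; exact: connect_trans su (connect1 st).
    have nst : ~~ stop (val u).
      by apply: contra nostep => st; rewrite /ps_step /= inE /= st ltr01.
    split=> //; apply: contraNT nostep => uE.
    by rewrite /ps_step /= inE /= (negPf nst) /= ps_act_enabled uE ltr01.
  have [||t tC|t /CP[u -> su] st] := hstop C.
  - by apply/set0Pn; exists (val s); apply/imsetP; exists s => //; exact: connect0.
  - by move=> t /CP[u -> /Cgo[]].
  - have [u tu su] := CP t tC; have [nst uE] := Cgo u su.
    have [_ /fintype.subsetP sub] := ec_closed ecE uE.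
    rewrite tu; apply/fintype.subsetP => v uv.
    apply/imsetP; exists (exist _ v (sub v uv)) => //.
    apply: connect_trans su (connect1 _).
    by rewrite /ps_step /= inE /= (negPf nst) /= uE; rewrite inE in uv.
  - by have [/negP] := Cgo u su.
case=> [s|[]]; [exact: conn_inl| |exact: connect0].
have := ps_act_enabled (ec_ps sigma stop ecE) (inr true).
rewrite inE => /existsP[[s|[]]] /= st; [|by rewrite ltxx in st..].
apply: connect_trans (connect1 _) (conn_inl s).
by rewrite /ps_step /= inE.
Qed.

(** [y] is the expected number of visits before the sink, finite because of [B]. The source term
    comes from the initial state; only states that continue inside [E] pass flow on. *)
Lemma ec_flow_exists (R : realType) (S Act : finType) (M : mdp R S Act)
    (sigma : ps_strategy M) (stop : pred S) (E : {set S * Act})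
    (ecE : is_ec M E) (B : S -> R) :
  (forall s, (ec_exp_visits (ec_ps sigma stop ecE) s <= (B (val s))%:E)%E) ->
  exists y : S -> R,
    (forall s, s \in states_of E -> 0 <= y s <= B s) /\
    (forall s, s \in states_of E -> y s = #|states_of E|%:R^-1 +
       \sum_(t | ((t, sigma t) \in E) && ~~ stop t)
         trans M t (sigma t) s * y t).
Proof.
set rho := ec_ps sigma stop ecE => hB.
pose v (u : ec_state E) := exp_reward (ec_init E) rho
  (visit_obj R (ec_action Act) [set ec_sink E]%SET u).
have v0 u : (0 <= v u)%E by exact: exp_reward_ge0.
pose w (s : {s | s \in states_of E}) := fine (v (inl s)).
have wE s : v (inl s) = (w s)%:E.
  (* [hB] applies to [v] because the rewards of [visit_obj] are the visit counts by conversion. *)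
  by rewrite fineK// ge0_fin_numE// (le_lt_trans (hB s))// ltry.
(* No transition enters the initial state, so it is visited once. *)
have vinit : v (inr true) = 1%E.
  rewrite /v exp_visits_flow ?inE// eqxx big1 ?adde0// => u _.
  by rewrite [trans _ _ _ _](_ : _ = 0) ?mul0e//; case: u => [s|[]] //=; case: ifP.
have flow s : w s = #|states_of E|%:R^-1 +
    \sum_(t : {s | s \in states_of E})
      ec_trans M (inl t) (ec_act sigma stop (inl t)) (inl s) * w t.
  apply: EFin_inj; rewrite -wE /v exp_visits_flow ?inE// add0e.
  rewrite big_sumType/= big_bool/= -!/(v _) vinit mule1 mul0e adde0 addeC EFinD.
  congr (_ + _)%E; rewrite -sumEFin; apply: eq_bigr => t _.
  by rewrite EFinM -wE.
pose y s := if insub s is Some u then w u else 0.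
have yE (u : {s | s \in states_of E}) : y (val u) = w u by rewrite /y valK.
exists y; split=> s sE; rewrite -[s]/(val (exist (fun s => s \in states_of E) s sE)) yE.
  by rewrite -!lee_fin -wE v0 hB.
rewrite flow; congr (_ + _).
rewrite [RHS](_ : _ = \sum_(t in states_of E)
    (if ((t, sigma t) \in E) && ~~ stop t then trans M t (sigma t) s * y t else 0)).
  rewrite [RHS]big_sub; apply: eq_bigr => t _; rewrite yE /=.
  by case: (stop _); rewrite ?mul0r ?andbF ?andbT //=; case: ifP; rewrite ?mul0r.
rewrite -big_mkcondr/=; apply: eq_bigl => t.
by case: (boolP ((t, _) \in E)) => [/mem_states_of ->//|]; rewrite andbF.
Qed.

(** * From a strategy to a solution of the constraints *)

Lemma sum_over_strategy (V : nmodType) (S Act : finType) (E : {set S * Act})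
    (f : S -> Act) (F : S * Act -> V) :
  (forall s b, b != f s -> F (s, b) = 0) ->
  \sum_(sb in E) F sb = \sum_(s | (s, f s) \in E) F (s, f s).
Proof.
move=> F0; rewrite big_mkcond [RHS]big_mkcond/=.
rewrite (eq_bigr (fun t => if (t.1, t.2) \in E then F (t.1, t.2) else 0)); last by case.
rewrite -(pair_bigA _ (fun s b => if (s, b) \in E then F (s, b) else 0))/=.
apply: eq_bigr => s _; rewrite (bigD1 (f s))//= big1 ?addr0// => b bs.
by rewrite F0//; case: ifP.
Qed.

(** Sum the flow equations over the component: the source terms add up to 1, and as [E] is closed,
    the flow inside [E] occurs on both sides and cancels. *)
Lemma exit_of_flow (R : realType) (S Act : finType) (M : mdp R S Act)
    (E : {set S * Act}) (z : S -> Act -> R) (zb : S -> R) :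
  is_ec M E ->
  (forall s, s \in states_of E ->
    zb s + \sum_(b in enabled M s) z s b = #|states_of E|%:R^-1 +
      \sum_(sb in pres M s :&: E) trans M sb.1 sb.2 s * z sb.1 sb.2) ->
  1 = \sum_(s in states_of E)
        (zb s + \sum_(b in enabled M s | (s, b) \notin E) z s b).
Proof.
move=> ecE flow.
have inE : \sum_(s in states_of E) \sum_(b in enabled M s | (s, b) \in E) z s b =
    \sum_(sb in E) z sb.1 sb.2.
  rewrite pair_big_dep/=; apply: eq_bigl => -[s b] /=.
  apply/and3P/idP => [[]//|sb]; split => //; first exact: mem_states_of sb.
  by have [] := ec_closed ecE sb.
have tot : \sum_(s in states_of E) (zb s + \sum_(b in enabled M s) z s b) =
    1 + \sum_(sb in E) z sb.1 sb.2.
  rewrite (eq_bigr _ flow) big_split/=; congr (_ + _).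
    rewrite sumr_const -[LHS]mulr_natr mulVf// pnatr_eq0 cards_eq0.
    have /and3P[/set0Pn[[s b] sb] _ _] := ecE.
    by apply/set0Pn; exists s; exact: mem_states_of sb.
  under eq_bigr do rewrite sum_pres.
  rewrite exchange_big/=; apply: eq_bigr => -[s b] sb /=.
  have [ben /fintype.subsetP sub] := ec_closed ecE sb.
  rewrite -mulr_suml (_ : \sum_(i in _) _ = 1) ?mul1r// -(trans_sum1 ben).
  rewrite [RHS](bigID (mem (states_of E)))/= [X in _ = _ + X]big1 ?addr0// => t tE.
  by apply: trans_eq0; apply: contra tE; exact: sub.
apply: (addIr (\sum_(sb in E) z sb.1 sb.2)); rewrite -tot -inE -big_split/=.
apply: eq_bigr => s _; rewrite -addrA; congr (_ + _).
by rewrite [LHS](bigID (fun b => (s, b) \in E))/= addrC.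
Qed.

(* The states with [e = 1] in the solution of C3 built from [sigma]. *)
Definition stop_at (R : realType) (S Act : finType) (M : mdp R S Act)
    (sigma : ps_strategy M) (V : S -> R) (E : {set S * Act}) (s : S) : bool :=
  (V s == 0) && [forall t, connect (ps_step sigma) s t ==> ((t, sigma t) \in E)].

(** Value 0 forces every term of the first-step sum to be 0, hence value 0 at each successor, and a
    successor reaches no further states. This yields the constraint of [ea] against [e] at
    successors. *)
Lemma stop_at_succ (R : realType) (S Act : finType) (M : mdp R S Act)
    (psi : objective R S Act) (sigma : ps_strategy M) (V : S -> R)
    (E : {set S * Act}) s t :
  (forall s, exp_reward s sigma psi = (V s)%:E) -> s \notin obj_goal psi ->
  t \in succs M s (sigma s) -> stop_at sigma V E s -> stop_at sigma V E t.
Proof.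
move=> VE sG st /andP[/eqP Vs /forallP sE].
have V0 u : 0 <= V u by rewrite -lee_fin -VE exp_reward_ge0.
apply/andP; split; last first.
  apply/forallP => u; apply/implyP => tu; apply: (implyP (sE u)).
  exact: connect_trans (connect1 st) tu.
have ge0 u : true -> 0 <= trans M s (sigma s) u * (obj_rew psi s (sigma s) u + V u).
  by move=> _; rewrite mulr_ge0 ?trans_ge0// addr_ge0// obj_rew_ge0.
have := exp_reward_ps VE sG; rewrite Vs => /esym/(psumr_eq0P ge0)/(_ t isT)/eqP.
move: st; rewrite inE => st; rewrite mulf_eq0 gt_eqF//= paddr_eq0 ?obj_rew_ge0//.
by case/andP.
Qed.

(** A state of value 0 in [C] qualifies, since [sigma] stays in [C] from there. This is the
    condition under which the sink is reached almost surely. *)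
Lemma stop_at_exists (R : realType) (S Act : finType) (M : mdp R S Act)
    (psi : objective R S Act) (sigma : ps_strategy M) (V : S -> R)
    (E : {set S * Act}) (C : {set S}) :
  (forall s, exp_reward s sigma psi = (V s)%:E) ->
  (forall s, s \in states_of E -> s \notin obj_goal psi) ->
  C != finset.set0 ->
  (forall s, s \in C -> (s, sigma s) \in E) ->
  (forall s, s \in C -> succs M s (sigma s) \subset C) ->
  exists2 s, s \in C & stop_at sigma V E s.
Proof.
move=> VE EG C0 CE Ccl.
have [|s sC Vs] := closed_value_zero VE C0 _ Ccl.
  by move=> s /CE/mem_states_of/EG.
exists s => //; rewrite /stop_at Vs eqxx /=; apply/forallP => t.
apply/implyP => st; apply: CE.
apply: (@connect_preserves _ (ps_step sigma) (fun x => x \in C)) st sC.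
by move=> x y xy xC; exact: (fintype.subsetP (Ccl _ xC)).
Qed.

(** For an action not chosen, [xa] is the largest value that the choice constraint allows: 0 for
    [>=] and [- U] for [<=]. *)
Lemma C1_of_strategy (R : realType) (S Act : finType) (M : mdp R S Act)
    (l : nat) (Q : query R S Act l) (p : 'rV[R]_l) (U : 'I_l -> S -> rat)
    (sigma : ps_strategy M) (V : 'I_l -> S -> R) :
  (forall j s, s \in S_maybe M (Q j) -> forall tau : strategy M,
     (exp_reward s tau (Q j) <= (ratr (U j s))%:E)%E) ->
  (forall j s, exp_reward s sigma (Q j) = (V j s)%:E) ->
  achieves Q sigma p ->
  C1 M Q p U (fun s b => (b == sigma s)%:R)
    (fun j s => cmp_eps R (obj_cmp (Q j)) * V j s)
    (fun j s b => if b == sigma s then cmp_eps R (obj_cmp (Q j)) * V j s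
                  else - (cmp_mu R (obj_cmp (Q j)) * ratr (U j s))).
Proof.
move=> hU VE ach.
have V0 j s : 0 <= V j s by rewrite -lee_fin -VE exp_reward_ge0.
have VU j s : s \in S_maybe M (Q j) -> V j s <= ratr (U j s).
  by move=> s1; rewrite -lee_fin -VE hU.
have U0 j s : s \in S_maybe M (Q j) -> 0 <= ratr (U j s) :> R.
  by move=> s1; exact: le_trans (V0 j s) (VU j s s1).
have eps2 (c : cmp) : cmp_eps R c * cmp_eps R c = 1.
  by case: c => /=; rewrite ?mul1r ?mulN1r ?opprK.
split.
- by move=> s b _; case: eqP; [right|left].
- move=> s; rewrite (bigD1 (sigma s)) ?ps_act_enabled//= eqxx big1 ?addr0//.
  by move=> b /andP[_ /negPf ->].
- move=> j s s0; have : V j s = 0.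
    by apply: EFin_inj; rewrite -VE; exact: S_zero_exp_reward.
  by move=> ->; rewrite mulr0.
- by move=> j s s1; rewrite mulrA eps2 mul1r V0 VU.
- move=> j s b s1 ben; case: ifP => _; first by rewrite mulrA eps2 mul1r V0 VU.
  case: (obj_cmp (Q j)) => /=; rewrite ?mul0r ?oppr0 ?mulr0 ?lexx ?U0//.
  by rewrite mul1r mulN1r opprK U0// lexx.
- move=> j s b s1 ben; have sG := S_maybe_notin_goal s1.
  rewrite (eq_bigr (fun s' => cmp_eps R (obj_cmp (Q j)) *
    (trans M s b s' * (obj_rew (Q j) s b s' + V j s')))); last first.
    by move=> s' _; rewrite -mulrDr mulrCA [V _ _ + _]addrC.
  rewrite -mulr_sumr; case: eqP => [->|_].
    by rewrite {1}(exp_reward_ps (VE j) sG).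
  (* For [<=], [U] bounds the value of taking [b] once and then following [sigma]; for [>=], the
     right-hand side is nonnegative. *)
  have := hU j s s1 (deviate sigma ben).
  rewrite (exp_reward_deviate ben (VE j) sG) lee_fin.
  case: (obj_cmp (Q j)) => /= le; last by rewrite mul1r mulN1r lerN2.
  rewrite mul0r oppr0 mul1r sumr_ge0// => s' _.
  by rewrite mulr_ge0 ?trans_ge0// addr_ge0// obj_rew_ge0.
- move=> j s b s1 ben; case: eqP => _; case: (obj_cmp (Q j)) => /=.
  + by rewrite mul1r subr0 mulr1 VU.
  + by rewrite subrr mulr0 mulN1r oppr_le0.
  + by rewrite mul0r subr0 oppr0 mulr0.
  + by rewrite mul1r sub0r mulrN1.
(* The values [- U] of the actions not chosen cancel the slack exactly. *)
- move=> j s s1; rewrite (bigD1 (sigma s)) ?ps_act_enabled//= eqxx -addrA lerDl.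
  rewrite (card_sub1_sum _ (ps_act_enabled sigma s)) mulr_sumr mulr_suml.
  rewrite -big_split/= big1// => b /andP[_ /negPf ->].
  by rewrite mulr1 addNr.
- move=> j; have := ach j; rewrite VE mulrA eps2 mul1r.
  by case: (obj_cmp (Q j)); rewrite /= lee_fin.
Qed.

Lemma C3_of_strategy (R : realType) (S Act : finType) (M : mdp R S Act)
    (l : nat) (Q : query R S Act l) (U : 'I_l -> S -> rat)
    (X : {set S * Act} -> S -> rat)
    (sigma : ps_strategy M) (V : 'I_l -> S -> R) :
  (forall j s, s \in S_maybe M (Q j) -> V j s <= ratr (U j s)) ->
  (forall j s, exp_reward s sigma (Q j) = (V j s)%:E) ->
  (forall j (E : {set S * Act}) (ecE : is_ec M E), is_mec M (Q j) E ->
     forall (s : {s : S | s \in states_of E}) (rho : ps_strategy (ec_mdp ecE)),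
       ec_reaches_sink rho ->
       (ec_exp_visits rho s <= (ratr (X E (val s)))%:E)%E) ->
  exists (e : 'I_l -> S -> R) (ea : 'I_l -> S -> Act -> R)
         (z : 'I_l -> S -> Act -> R) (zb : 'I_l -> S -> R),
    C3 M Q U X (fun s b => (b == sigma s)%:R)
      (fun j s => cmp_eps R (obj_cmp (Q j)) * V j s) e ea z zb.
Proof.
move=> VU VE hX.
have EG j E s : is_mec M (Q j) E -> s \in states_of E -> s \notin obj_goal (Q j).
  by move=> mE sE; exact: S_maybe_notin_goal (mec_state mE sE).
(* Stated for all pairs, with [is_mec] as a premise of the property, so that [choice] yields one
   total function. *)
have flowE (jE : 'I_l * {set S * Act}) : exists y : S -> R, is_mec M (Q jE.1) jE.2 ->
    (forall s, s \in states_of jE.2 -> 0 <= y s <= ratr (X jE.2 s)) /\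
    (forall s, s \in states_of jE.2 -> y s = #|states_of jE.2|%:R^-1 +
       \sum_(t | ((t, sigma t) \in jE.2) && ~~ stop_at sigma (V jE.1) jE.2 t)
         trans M t (sigma t) s * y t).
  case: jE => j E /=; have [mE|_] := boolP (is_mec M (Q j) E); last by exists (fun=> 0).
  have ecE := mec_ec mE.
  have [|y yP] := @ec_flow_exists _ _ _ _ sigma (stop_at sigma (V j) E) _ ecE
    (fun s => ratr (X E s)); last by exists y.
  move=> s; apply: (hX _ _ _ mE); apply: ec_ps_reaches_sink => C.
  by apply: stop_at_exists (VE j) _ => s' s'E; exact: EG mE s'E.
have [y yP] := choice flowE.
(* The maximal end component containing [s], or the empty set if there is none. *)
pose mec j s := odflt finset.set0
  [pick E | is_mec M (Q j) E && (s \in states_of E)].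
have mecE j E s : is_mec M (Q j) E -> s \in states_of E -> mec j s = E.
  move=> mE sE; rewrite /mec; case: pickP => [F /andP[mF sF]|/(_ E)] /=.
    exact: mec_unique mF mE sF sE.
  by rewrite mE sE.
pose st j s := stop_at sigma (V j) (mec j s) s.
have stE j E s : is_mec M (Q j) E -> s \in states_of E ->
    st j s = stop_at sigma (V j) E s.
  by move=> mE sE; rewrite /st (mecE _ _ _ mE sE).
have st_in j E s : is_mec M (Q j) E -> s \in states_of E -> st j s ->
    (s, sigma s) \in E.
  move=> mE sE; rewrite (stE _ _ _ mE sE) => /andP[_ /forallP/(_ s)].
  by rewrite connect0.
(* All visits to a state go to the stopping action if [e] is 1 there, and to the action of [sigma]
   otherwise. *)
pose z j s b := if (b == sigma s) && ~~ st j s then y (j, mec j s) s else 0.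
pose zb j s := if st j s then y (j, mec j s) s else 0.
have bounds j E s : is_mec M (Q j) E -> s \in states_of E ->
    0 <= y (j, mec j s) s <= ratr (X E s).
  by move=> mE sE; rewrite (mecE _ _ _ mE sE); exact: (yP (j, E) mE).1.
have X0 j E s : is_mec M (Q j) E -> s \in states_of E -> 0 <= ratr (X E s) :> R.
  by move=> mE sE; have /andP[h1 h2] := bounds _ _ _ mE sE; exact: le_trans h2.
have flow j E s : is_mec M (Q j) E -> s \in states_of E ->
    zb j s + \sum_(b in enabled M s) z j s b =
    #|states_of E|%:R^-1 +
      \sum_(sb in pres M s :&: E) trans M sb.1 sb.2 s * z j sb.1 sb.2.
  move=> mE sE; rewrite sum_pres.
  rewrite (sum_over_strategy (f := sigma) _); last first.
    by move=> t b /negPf bt; rewrite /z /= bt mulr0.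
  rewrite (bigD1 (sigma s)) ?ps_act_enabled//= big1 ?addr0; last first.
    by move=> b /andP[_ /negPf bs]; rewrite /z bs.
  have -> : zb j s + z j s (sigma s) = y (j, E) s.
    rewrite /zb /z eqxx /= (mecE _ _ _ mE sE).
    by case: (st j s); rewrite ?addr0 ?add0r.
  rewrite ((yP (j, E) mE).2 s sE) /= big_mkcondr; congr (_ + _).
  apply: eq_bigr => t tE; have tS := mem_states_of tE.
  rewrite /z eqxx /= (stE _ _ _ mE tS) (mecE _ _ _ mE tS).
  by case: ifP; rewrite ?mulr0.
exists (fun j s => (st j s)%:R), (fun j s b => ((b == sigma s) && st j s)%:R), z, zb.
split.
- by move=> j E s _ _; case: (st j s); [right|left].
- move=> j E s mE sE; have s1 := mec_state mE sE.
  rewrite mulrA (_ : cmp_eps R _ * _ = 1) ?mul1r; last first.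
    by case: (obj_cmp _) => /=; rewrite ?mul1r ?mulN1r ?opprK.
  have [|_] := boolP (st j s); last by rewrite subr0 mulr1 VU.
  by rewrite (stE _ _ _ mE sE) => /andP[/eqP -> _]; rewrite subrr mulr0.
- by move=> j E s b _ _; case: (_ && _); [right|left].
- by move=> j E s b _ _; rewrite ler_nat; case: (b == _) => //; case: (st j s).
- move=> j E s b s' mE sb ss'; rewrite ler_nat.
  case: eqVneq => [bs|//]; rewrite /= bs in ss' sb.
  have [_ /fintype.subsetP sub] := ec_closed (mec_ec mE) sb.
  have sE := mem_states_of sb; rewrite (stE _ _ _ mE sE) (stE _ _ _ mE (sub _ ss')).
  have [h|//] := boolP (stop_at _ _ _ s).
  by rewrite (stop_at_succ (VE j) (EG _ _ _ mE sE) ss' h).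
- move=> j E s mE sE; have [sst|_] := boolP (st j s); last first.
    by rewrite big1// => b _; rewrite andbF.
  rewrite (bigD1 (sigma s)) ?(st_in _ _ _ mE sE sst)//= eqxx big1 ?addr0//.
  by move=> b /andP[_ /negPf ->].
- move=> j E s b mE sE _; rewrite /z; case: eqP => _ /=; last by rewrite mulr0 lexx.
  rewrite mulr1; case: (st j s) => /=; last exact: bounds.
  by rewrite lexx (X0 _ _ _ mE sE).
- move=> j E s mE sE; rewrite /zb; case: (st j s); last by rewrite mulr0 lexx.
  by rewrite mulr1; exact: bounds.
- exact: flow.
- by move=> j E mE; apply: exit_of_flow (mec_ec mE) _ => s; exact: flow.
Qed.

Theorem theorem4 (R : realType) (S Act : finType) (M : mdp R S Act)
    (l : nat) (Q : query R S Act l) (p : 'rV[R]_l)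
    (U : 'I_l -> S -> rat) (X : {set S * Act} -> S -> rat)
    (hfin : forall (j : 'I_l) (s : S) (sigma : ps_strategy M),
       (exp_reward s sigma (Q j) < +oo)%E)
    (hU : forall (j : 'I_l) (s : S), s \in S_maybe M (Q j) ->
       forall sigma : strategy M,
         (exp_reward s sigma (Q j) <= (ratr (U j s))%:E)%E)
    (hX : forall (j : 'I_l) (E : {set S * Act}) (ecE : is_ec M E),
       is_mec M (Q j) E ->
       forall (s : {s : S | s \in states_of E})
              (sigma : ps_strategy (ec_mdp ecE)),
         ec_reaches_sink sigma ->
         (ec_exp_visits sigma s <= (ratr (X E (val s)))%:E)%E) :
  (exists (a : S -> Act -> R)
          (x : 'I_l -> S -> R) (xa : 'I_l -> S -> Act -> R)
          (e : 'I_l -> S -> R) (ea : 'I_l -> S -> Act -> R)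
          (z : 'I_l -> S -> Act -> R) (zb : 'I_l -> S -> R),
     C1 M Q p U a x xa /\ C3 M Q U X a x e ea z zb) <->
  Ach_PS M Q p.
Proof.
split=> [[a [x [xa [e [ea [z [zb [c1 c3]]]]]]]]|[sigma ach]].
  have [sigma aE] := C1_strategy c1; exists sigma => j.
  have := C1_point c1 j.
  case cj : (obj_cmp (Q j)); rewrite /= ?mul1r ?mulN1r => xp.
    apply: le_trans (C1_C3_exp_reward_ge c1 c3 aE _ cj); first by rewrite lee_fin.
    by move=> s; exact: hfin.
  by apply: le_trans (C1_exp_reward_le c1 aE cj) _; rewrite lee_fin.
pose V j s := fine (exp_reward s sigma (Q j)).
have VE j s : exp_reward s sigma (Q j) = (V j s)%:E.
  by rewrite fineK// ge0_fin_numE ?exp_reward_ge0// hfin.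
have [|e [ea [z [zb c3]]]] := C3_of_strategy (U := U) _ VE hX.
  by move=> j s s1; rewrite -lee_fin -VE hU.
(* Unification with [C1_of_strategy] supplies [a], [x] and [xa]. *)
by do 3 eexists; exists e, ea, z, zb; split; [exact: C1_of_strategy|exact: c3].
Qed.
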